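(* Let $n\ge 2$, let $G_1,\dots,G_n$ be non-trivial finitely generated groups with finite generating sets $S_1,\dots,S_n$, and let $\mathcal{G}$ be the Cayley graph of the free product $G_1*\cdots*G_n$ with respect to $\bigcup_{i=1}^n S_i$. Let $\chi_i(p)=\mathrm{E}_p(|C|_{G_i})$ be the expected size of the cluster containing the origin in the Cayley graph of $G_i$ with respect to $S_i$. Then the critical probability $p_c$ of Bernoulli bond percolation on $\mathcal{G}$ satisfies $0<p_c\le 1$ and is the unique solution $p\in(0,1]$ (a solution being a $p$ for which all $\chi_i(p)$ are finite and the equation holds) of $$\sum_{j=1}^n\prod_{i=1,i\neq j}^n\chi_i(p)-(n-1)\prod_{i=1}^n\chi_i(p)=0.$$
   Context: Cayley graph: for a group $G$ with finite generating set $S$, the graph has vertex set $G$, and $g,h$ are adjacent iff $g^{-1}h\in S$ or $h^{-1}g\in S$, with the appropriate multiplicity (one edge joining $g$ and $gs$ for each pair $(g,s)\in G\times S$). The origin $o$ is the identity element. Bernoulli bond percolation with parameter $p\in[0,1]$ on a graph: each edge is independently open with probability $p$ and closed otherwise; $\mathrm{P}_p$ is the resulting product probability measure and $\mathrm{E}_p$ its expectation. A cluster is a connected component of the random subgraph (on all vertices) of open edges; $C$ is the cluster containing $o$, and $|C|$ is its number of vertices (written $|C|_G$ when the graph is the Cayley graph of $G$). The percolation function is $\theta(p)=\mathrm{P}_p(|C|=\infty)$ and the critical probability is $p_c=\inf\{p\in[0,1]:\theta(p)>0\}$. *)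

(* Defs.v *)
From HB Require Import structures.
From Stdlib Require Import Relation_Operators.
From mathcomp Require Import all_boot all_order all_algebra finmap.
From mathcomp Require Import all_classical all_reals all_analysis measurable_realfun.
From mathcomp Require Import zify ring lra.

Set Implicit Arguments.
Unset Strict Implicit.
Unset Printing Implicit Defensive.

Import Order.TTheory GRing.Theory Num.Theory.
Local Open Scope classical_set_scope.
Local Open Scope ring_scope.

(** * Free products of groups

   Elements are the reduced words: finite sequences of non-identity letters in
   which consecutive letters come from different factors. The product is
   concatenation followed by reduction, performed one letter at a time. *)

Section Words.
Variables (I : choiceType) (G : I -> groupType).

Definition letter := {i : I & G i}.

Implicit Types (a b : letter) (u v w : seq letter).

Definition reduced w : bool :=
  all (fun a => tagged a != 1%g) w && sorted (fun a b => tag a != tag b) w.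

Definition consw a w : seq letter :=
  if tagged a == 1%g then w else
  if w is b :: w' then
    if tag a == tag b then
      let y := (tagged a * tagged_as a b)%g in
      if y == 1%g then w' else Tagged G y :: w'
    else a :: w
  else [:: a].

Definition mulw u v : seq letter := foldr consw v u.

Definition invw u : seq letter := rev [seq Tagged G (tagged a)^-1%g | a <- u].

Lemma reduced_behead a w : reduced (a :: w) -> reduced w.
Proof.
by case/andP => /= /andP[_ aw] pw; rewrite /reduced aw/= (path_sorted pw).
Qed.

Lemma reduced_head a w : reduced (a :: w) -> tagged a != 1%g.
Proof. by case/andP => /= /andP[]. Qed.

Lemma reduced_cons a w : tagged a != 1%g ->
  (if w is b :: _ then tag a != tag b else true) -> reduced w ->
  reduced (a :: w).
Proof.
move=> a1; case: w => [|b w] ab /andP[/= aw sw]; rewrite /reduced/= a1//.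
by rewrite ab aw sw.
Qed.

Lemma consw_reduced a w : reduced w -> reduced (consw a w).
Proof.
rewrite /consw; case: ifPn => // a1.
case: w => [_|b w rw]; first by rewrite /reduced/= a1.
case: ifPn => [/eqP ab|ab]; last exact: reduced_cons.
case: ifPn => [_|y1]; first exact: reduced_behead rw.
apply: reduced_cons => //; last exact: reduced_behead rw.
by case: w rw => // c w; rewrite /reduced/= ab => /andP[_ /andP[]].
Qed.

Lemma consw_id a w : reduced (a :: w) -> consw a w = a :: w.
Proof.
move=> raw; rewrite /consw (negbTE (reduced_head raw)).
case: w raw => // b w; rewrite /reduced/= => /andP[_ /andP[ab _]].
by rewrite (negbTE ab).
Qed.

Lemma consw1 i w : consw (Tagged G (1%g : G i)) w = w.
Proof. by rewrite /consw eqxx. Qed.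

Lemma tagged_as_existT i (x y : G i) :
  tagged_as (Tagged G x) (existT G i y) = y.
Proof. exact: tagged_asE. Qed.

Lemma conswM i (x y : G i) w : reduced w ->
  consw (Tagged G x) (consw (Tagged G y) w) = consw (Tagged G (x * y)%g) w.
Proof.
move=> rw; have [->|x1] := eqVneq x 1%g; first by rewrite consw1 mul1g.
have [->|y1] := eqVneq y 1%g; first by rewrite consw1 mulg1.
rewrite [consw (Tagged G y) w]/consw /= (negbTE y1).
case: w rw => [_|[j z] w rw].
  rewrite /consw/= (negbTE x1) eqxx tagged_asE.
  by case: ifP.
have z1 := reduced_head rw; rewrite /= in z1 *.
have [ij|ij] := eqVneq i j; last first.
  rewrite [in LHS]/consw/= (negbTE x1) eqxx tagged_asE /consw/= (negbTE ij).
  by case: ifP.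
case: j / ij z z1 rw => z z1 rw.
rewrite tagged_as_existT.
have xyE : consw (Tagged G (x * y)%g) (existT _ i z :: w) =
    if (x * y * z == 1)%g then w else Tagged G (x * y * z)%g :: w.
  rewrite /consw/= eqxx tagged_as_existT.
  by case: ifPn => // /eqP ->; rewrite mul1g (negbTE z1).
rewrite xyE -mulgA; have [yz1|yz1] := eqVneq (y * z)%g 1%g.
  rewrite yz1 mulg1 (negbTE x1) consw_id//.
  apply: reduced_cons => //; last exact: reduced_behead rw.
  by case: w rw {xyE} => // c w; rewrite /reduced/= => /andP[_ /andP[]].
by rewrite /consw/= (negbTE x1) eqxx tagged_asE.
Qed.

Lemma mulw_reduced u v : reduced v -> reduced (mulw u v).
Proof. by move=> rv; elim: u => //= a u IH; exact: consw_reduced. Qed.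

Lemma mulw_consw a u v : reduced u -> reduced v ->
  mulw (consw a u) v = consw a (mulw u v).
Proof.
move=> ru rv; rewrite [in LHS]/consw; case: ifPn => [/eqP a1|a1].
  by case: a a1 => i x /= ->; rewrite consw1.
case: u ru => // -[j z] u ru; case: a a1 => i x /= x1.
have [ij|//] := eqVneq i j.
case: j / ij z ru => z ru.
rewrite tagged_as_existT.
rewrite (@conswM i x z); last exact: mulw_reduced.
by case: eqVneq => // ->; rewrite consw1.
Qed.

Lemma mulwA u v w : reduced u -> reduced v -> reduced w ->
  mulw u (mulw v w) = mulw (mulw u v) w.
Proof.
move=> ru rv rw; elim: u ru => //= a u IH rau.
by rewrite IH ?(reduced_behead rau)// mulw_consw//; exact: mulw_reduced.
Qed.

Lemma mulw0 u : reduced u -> mulw u [::] = u.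
Proof.
elim: u => //= a u IH rau; rewrite IH ?(reduced_behead rau)//.
exact: consw_id.
Qed.

Lemma invw_reduced u : reduced u -> reduced (invw u).
Proof.
case/andP=> au su; apply/andP; split.
  by rewrite all_rev all_map; apply: sub_all au => a /=; rewrite invg_eq1.
rewrite rev_sorted sorted_map; apply: sub_sorted su => a b /=.
by rewrite eq_sym.
Qed.

Lemma invwK u : invw (invw u) = u.
Proof.
rewrite /invw map_rev revK -map_comp -[RHS]map_id.
by apply: eq_map => -[i x] /=; rewrite invgK.
Qed.

Lemma mulVw u : reduced u -> mulw (invw u) u = [::].
Proof.
elim: u => // -[i x] u IH rau.
rewrite /invw map_cons rev_cons -/(invw u) /mulw -cats1 foldr_cat /=.
rewrite -(consw_id rau) conswM ?(reduced_behead rau)// mulVg consw1.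
exact/IH/reduced_behead/rau.
Qed.

Lemma mulwV u : reduced u -> mulw u (invw u) = [::].
Proof. by move=> ru; rewrite -{1}(invwK u) mulVw// invw_reduced. Qed.

End Words.

Section FreeProduct.
Variables (I : choiceType) (G : I -> groupType).

Record free_product := FreeProduct {
  word :> seq (letter G) ;
  word_reduced : reduced word }.

HB.instance Definition _ := [isSub for word].
HB.instance Definition _ := [Choice of free_product by <:].

Implicit Types g h : free_product.

Definition fp_one : free_product := @FreeProduct [::] isT.
Definition fp_mul g h : free_product :=
  FreeProduct (mulw_reduced g (word_reduced h)).
Definition fp_inv g : free_product :=
  FreeProduct (invw_reduced (word_reduced g)).

Lemma fp_mulA : associative fp_mul.
Proof. by move=> g h k; apply/val_inj/mulwA; exact: word_reduced. Qed.
Lemma fp_mul1g : left_id fp_one fp_mul.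
Proof. by move=> g; exact/val_inj. Qed.
Lemma fp_mulg1 : right_id fp_one fp_mul.
Proof. by move=> g; apply/val_inj/mulw0; exact: word_reduced. Qed.
Lemma fp_mulVg : left_inverse fp_one fp_inv fp_mul.
Proof. by move=> g; apply/val_inj/mulVw; exact: word_reduced. Qed.
Lemma fp_mulgV : right_inverse fp_one fp_inv fp_mul.
Proof. by move=> g; apply/val_inj/mulwV; exact: word_reduced. Qed.

HB.instance Definition _ := isGroup.Build free_product
  fp_mulA fp_mul1g fp_mulg1 fp_mulVg fp_mulgV.

(** The canonical embedding of the factor [G i]: [x] is sent to the one-letter
   word [x], and [1] to the empty word. *)
Definition fp_in (i : I) (x : G i) : free_product :=
  FreeProduct (@consw_reduced _ _ (Tagged G x) [::] isT).

Lemma fp_inM i : {morph @fp_in i : x y / (x * y)%g}.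
Proof.
move=> x y; apply/val_inj => /=.
by rewrite -conswM// mulw_consw//; exact: consw_reduced.
Qed.

End FreeProduct.

Arguments fp_in {I G} i x.

(** * Bernoulli measures on edge configurations *)

Definition edge_events (E : choiceType) : set (set (E -> bool)) :=
  [set [set w : E -> bool | w e] | e in [set: E]].

(** A configuration maps an edge to [true] when it is open; configurations carry
   the product sigma-algebra. *)
Definition config (E : choiceType) := g_sigma_algebraType (@edge_events E).
HB.instance Definition _ (E : choiceType) := Measurable.on (config E).

Section BernoulliMeasure.
Variables (R : realType) (E : choiceType).
Local Open Scope ereal_scope.

Definition is_bernoulli (p : R) (P : probability (config E) R) : Prop :=
  forall (F : {fset E}) (b : E -> bool),
    P [set w : config E | forall e, e \in F -> w e = b e] =
    (\prod_(e <- F) (if b e then p else 1 - p)%R)%:E.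

(** The product measure, specified by its values on cylinders: for [E] countable
   and [0 <= p <= 1] it exists by [bernoulliP], and it is unique by
   [is_bernoulli_unique]. *)
Definition bernoulli (p : R) : probability (config E) R :=
  get [set P | is_bernoulli p P].

Lemma is_bernoulli_unique (p : R) (P Q : probability (config E) R) :
  is_bernoulli p P -> is_bernoulli p Q ->
  forall A, measurable A -> P A = Q A.
Proof.
move=> hP hQ A mA.
pose C (F : {fset E}) : set (config E) := [set w : config E | forall e, e \in F -> w e].
have CE F : C F = [set w : config E | forall e, e \in F -> w e = true] by [].
pose G : set (set (config E)) := range C.
have mC F : measurable (C F).
  rewrite (_ : C F = \bigcap_(e in [set` F]) [set w : config E | w e]); last first.
    by apply/seteqP; split => w /= h e; exact: h.
  apply: fin_bigcap_measurable; first exact: finite_fset.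
  by move=> e _; apply: sub_sigma_algebra; exists e.
apply: (@g_sigma_algebra_measure_unique _ R (config E) G _ (fun=> setT)) => //.
- by move=> _ [F _ <-]; exact: mC.
- by move=> _; exists fset0 => //; apply/seteqP; split.
- by rewrite bigcup_const//; exists 0%N.
- move=> _ _ [F1 _ <-] [F2 _ <-]; exists (F1 `|` F2)%fset => //.
  apply/seteqP; split => [w h|w [h1 h2] e].
    by split=> e eF; apply: h; rewrite in_fsetU eF ?orbT.
  by rewrite in_fsetU => /orP[]; [exact: h1|exact: h2].
- move=> _ [F _ <-]; rewrite CE.
  exact: etrans (hP F (fun=> true)) (esym (hQ F (fun=> true))).
- by move=> _; rewrite /= (@probability_setT _ _ _ P) ltry.
apply: (smallest_sub (smallest_sigma_algebra _ _)) mA => _ [e _ <-].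
apply: sub_sigma_algebra; exists [fset e]%fset => //.
by apply/seteqP; split=> w /= => [/(_ e (fset11 e))|h _ /fset1P ->].
Qed.

End BernoulliMeasure.

(** The measure is realised on the unit interval by expanding a uniform point
   into independent digits: the first digit is [x < p], after which [[0, p[] or
   [[p, 1[] is rescaled to the unit interval. *)
Section BernoulliExistence.
Variables (R : realType) (p : R).
Hypothesis p01 : 0 <= p <= 1.

Let step (x : R) : R := if x < p then x / p else (x - p) / (1 - p).
Let digit (x : R) (k : nat) : bool := iter k step x < p.
Let wt (b : bool) : R := if b then p else 1 - p.

Let wt_ge0 b : 0 <= wt b.
Proof. by case/andP: p01 => p0 p1; case: b; rewrite /wt ?subr_ge0. Qed.

Let measurable_iter_step k : measurable_fun [set: R] (iter k step).
Proof.
elim: k => [|k IH]; first exact: measurable_id.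
apply: (measurableT_comp (f := step)) => //.
apply: measurable_fun_ifT.
- exact: measurable_fun_ltr.
- exact: measurable_funM.
- by apply: measurable_funM => //; exact: measurable_funB.
Qed.

Let digitS x k : digit x k.+1 = digit (step x) k.
Proof. by rewrite /digit iterSr. Qed.

Let prefix_itv (N : nat) (b : nat -> bool) : exists2 l : R,
  (0 <= l) && (l + \prod_(k < N) wt (b k) <= 1) &
  forall x, 0 <= x < 1 ->
    (forall k, (k < N)%N -> digit x k = b k) <->
    l <= x < l + \prod_(k < N) wt (b k).
Proof.
case/andP: p01 => p0 p1.
elim: N b => [|N IH] b.
  by exists 0; rewrite ?big_ord0 ?add0r ?lexx// => x x01; split.
have [l /andP[l0 lm1] hl] := IH (fun k => b k.+1).
rewrite big_ord_recl.
rewrite [X in wt _ * X](_ : _ = \prod_(k < N) wt (b k.+1)); last by [].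
set m := \prod_(k < N) wt (b k.+1) in lm1 hl *.
have m0 : 0 <= m by apply: prodr_ge0.
have split_dig x : (forall k, (k < N.+1)%N -> digit x k = b k) <->
    (x < p) = b 0%N /\ (forall k, (k < N)%N -> digit (step x) k = b k.+1).
  split=> [h|[h0 h] [|k] kN].
  - by split=> [|k kN]; [exact: (h 0%N)|rewrite -digitS; exact: h].
  - exact: h0.
  - by rewrite digitS; exact: h.
case b0 : (b 0%N); rewrite /wt /= -/wt.
- exists (p * l).
    rewrite mulr_ge0//= -mulrDr; nra.
  move=> x /andP[x0 x1]; rewrite split_dig b0 -mulrDr.
  have [xp|px] := ltP x p; last first.
    split=> [[]//|/andP[_ xlt]]; exfalso; nra.
  have pgt0 : 0 < p by exact: le_lt_trans xp.
  have -> : step x = x / p by rewrite /step xp.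
  have y01 : 0 <= x / p < 1.
    by rewrite divr_ge0//= ltr_pdivrMr// mul1r.
  have -> : (p * l <= x < p * (l + m)) = (l <= x / p < l + m).
    by rewrite ler_pdivlMr// ltr_pdivrMr// mulrC (mulrC p).
  by rewrite -hl//; split=> [[]|].
- exists (p + (1 - p) * l).
    rewrite addr_ge0//= ?mulr_ge0 ?subr_ge0//=; nra.
  move=> x /andP[x0 x1]; rewrite split_dig b0.
  have [xp|px] := ltP x p.
    split=> [[]//|/andP[xge _]]; exfalso; nra.
  have pgt0 : 0 < 1 - p by rewrite subr_gt0; exact: le_lt_trans x1.
  have -> : step x = (x - p) / (1 - p) by rewrite /step ltNge px.
  have y01 : 0 <= (x - p) / (1 - p) < 1.
    by rewrite divr_ge0 ?subr_ge0//= ltr_pdivrMr// mul1r ltrD2r.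
  have -> : (p + (1 - p) * l <= x < p + (1 - p) * l + (1 - p) * m) =
      (l <= (x - p) / (1 - p) < l + m).
    rewrite ler_pdivlMr// ltr_pdivrMr// lerBrDl ltrBlDl mulrC.
    by rewrite -addrA (mulrDl l) (mulrC m) mulrC.
  by rewrite -hl//; split=> [[]|].
Qed.

Let I01 : set R := [set x | 0 <= x < 1].
Let cyl (N : nat) (d b : nat -> bool) : set R :=
  I01 `&` [set x | forall k, (k < N)%N -> d k -> digit x k = b k].

Let mI01 : measurable I01.
Proof.
rewrite (_ : I01 = `[0, 1[%classic); first exact: measurable_itv.
by apply/seteqP; split=> x; rewrite /= in_itv.
Qed.

Let mdigit k b : measurable [set x | digit x k = b].
Proof.
have m : measurable_fun [set: R] (fun x => digit x k).
  by apply: measurable_fun_ltr.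
by have := m measurableT [set b] I; rewrite setTI.
Qed.

Let mcyl N d b : measurable (cyl N d b).
Proof.
apply: measurableI => //.
rewrite (_ : [set x | _] =
  \bigcap_(k in [set k | (k < N)%N && d k]) [set x | digit x k = b k]).
  apply: fin_bigcap_measurable => //.
  by apply: (sub_finite_set _ (finite_II N)) => k /= /andP[].
apply/seteqP; split=> x /= h k.
  by move=> /andP[kN dk]; exact: h.
by move=> kN dk; apply: h; rewrite /= kN.
Qed.

Let cyl_measure N d b :
  lebesgue_measure (cyl N d b) = (\prod_(k < N | d k) wt (b k))%:E.
Proof.
suff H : forall j, (j <= N)%N -> forall b,
    lebesgue_measure (cyl N (fun k => (k < N - j)%N || d k) b) =
    (\prod_(k < N | (k < N - j)%N || d k) wt (b k))%:E.
  by have := H N (leqnn N) b; rewrite subnn.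
elim=> [|j IH] jN {}b.
  rewrite subn0 (eq_bigl xpredT); last by move=> k; rewrite ltn_ord.
  have [l /andP[l0 lm1] hl] := prefix_itv N b.
  rewrite (_ : cyl _ _ _ = `[l, l + \prod_(k < N) wt (b k)[%classic).
    have m0 : 0 <= \prod_(k < N) wt (b k) by apply: prodr_ge0.
    rewrite lebesgue_measure_itv/= lte_fin.
    case: ltP => [_|ml]; first by rewrite -EFinD addrAC subrr add0r.
    by congr _%:E; apply/eqP; rewrite eq_le m0/= -(lerD2l l) addr0.
  apply/seteqP; split=> x /=; rewrite in_itv/=.
    by move=> [x01 h]; apply/(hl x x01) => k kN; apply: h; rewrite ?kN.
  move=> xl; have x01 : 0 <= x < 1.
    case/andP: xl => lx xlm.
    by rewrite (le_trans l0 lx) (lt_le_trans xlm lm1).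
  by split=> // k kN _; apply: (hl x x01).2.
set i := (N - j.+1)%N.
have iN : (i < N)%N by rewrite /i; lia.
have ij : (N - j)%N = i.+1 by rewrite /i; lia.
have {}IH := IH (ltnW jN); rewrite ij in IH.
have ltSE k : (k < i.+1)%N = (k == i) || (k < i)%N by rewrite ltnS leq_eqVlt.
have [di|di] := boolP (d i).
  have dE k : (k < i)%N || d k = (k < i.+1)%N || d k.
    by rewrite ltSE; case: eqVneq => // ->; rewrite di orbT.
  rewrite (_ : (fun k => _) = (fun k => (k < i.+1)%N || d k)); last first.
    by apply/funext => k.
  rewrite IH; congr _%:E; apply: eq_bigl => k; by rewrite -dE.
pose b' c := fun k => if k == i then c else b k.
have -> : cyl N (fun k => (k < i)%N || d k) b =
    cyl N (fun k => (k < i.+1)%N || d k) (b' true) `|`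
    cyl N (fun k => (k < i.+1)%N || d k) (b' false).
  apply/seteqP; split=> x.
    move=> [x01 h].
    have h' k : (k < N)%N -> (k < i.+1)%N || d k -> digit x k = b' (digit x i) k.
      rewrite /b'; case: eqVneq => [->//|ki] kN; rewrite ltSE.
      by rewrite (negbTE ki); exact: h.
    by move: h'; case: (digit x i) => h'; [left|right]; split.
  suff H c : cyl N (fun k => (k < i.+1)%N || d k) (b' c) x ->
             cyl N (fun k => (k < i)%N || d k) b x by case=> /H.
  move=> [x01 h]; split=> // k kN kd.
  rewrite h//; last by rewrite ltSE -orbA kd orbT.
  rewrite /b'; case: eqVneq => // ki; exfalso.
  by move: kd; rewrite ki ltnn (negbTE di).
rewrite measureU; try exact: mcyl; first last.
  apply/seteqP; split=> // x [[_ h1] [_ h2]].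
  have := h1 i iN; rewrite ltnSn => /(_ isT) e1.
  by have := h2 i iN; rewrite ltnSn => /(_ isT); rewrite e1 /b' eqxx.
rewrite [X in (X + _)%E](IH (b' true)) [X in (_ + X)%E](IH (b' false)).
rewrite -EFinD; congr _%:E.
have prodE c : \prod_(k < N | (k < i.+1)%N || d k) wt (b' c k) =
    wt c * \prod_(k < N | (k < i)%N || d k) wt (b k).
  rewrite (bigD1 (Ordinal iN))/= ?ltnSn// /b' eqxx; congr (_ * _).
  apply: eq_big => [k|k /andP[_ /negbTE ki]].
    rewrite -val_eqE/= ltSE; case: eqVneq => [->|]; last by rewrite andbT.
    by rewrite ltnn (negbTE di).
  by rewrite -val_eqE/= in ki; rewrite ki.
by rewrite !prodE -mulrDl /wt addrC subrK mul1r.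
Qed.

Variables (E : choiceType) (f : E -> nat).
Hypothesis f_inj : injective f.

Let expand (x : R) : config E := fun e => digit x (f e).

Let mexpand : measurable_fun [set: R] expand.
Proof.
apply: (@measurability _ _ _ _ setT expand (@edge_events E)) => //.
move=> _ [_ [e _ <-] <-]; rewrite setTI.
exact: mdigit (f e) true.
Qed.

Definition digit_law (A : set (config E)) : \bar R :=
  lebesgue_measure (I01 `&` expand @^-1` A).

Let mpre (A : set (config E)) :
  measurable A -> measurable (I01 `&` expand @^-1` A).
Proof.
by move=> mA; apply: measurableI => //; rewrite -[X in measurable X]setTI; exact: mexpand.
Qed.

Let digit_law0 : digit_law set0 = 0%E.
Proof. by rewrite /digit_law preimage_set0 setI0 measure0. Qed.

Let digit_law_ge0 A : (0 <= digit_law A)%E.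
Proof. exact: measure_ge0. Qed.

Let digit_law_sigma_additive : semi_sigma_additive digit_law.
Proof.
move=> A mA tA mUA; rewrite /digit_law preimage_bigcup setI_bigcupr.
apply: measure_semi_sigma_additive => [k||].
- exact: mpre.
- apply/trivIsetP => i j _ _ ij; rewrite setIACA -[X in _ `&` X]preimage_setI.
  by move/trivIsetP : tA => /(_ i j I I ij) ->; rewrite preimage_set0 setI0.
- by rewrite -setI_bigcupr -preimage_bigcup; exact: mpre.
Qed.

HB.instance Definition _ := isMeasure.Build _ _ _ digit_law
  digit_law0 digit_law_ge0 digit_law_sigma_additive.

Let digit_law_setT : digit_law setT = 1%E.
Proof.
rewrite /digit_law preimage_setT.
rewrite (_ : I01 `&` setT = cyl 0 xpredT xpredT).
  by rewrite cyl_measure big_ord0.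
by congr (_ `&` _); apply/seteqP; split.
Qed.

HB.instance Definition _ :=
  Measure_isProbability.Build _ _ _ digit_law digit_law_setT.

Lemma bernoulli_existence : exists P : probability (config E) R, is_bernoulli p P.
Proof.
exists digit_law => F b /=; rewrite /digit_law.
pose N := (\max_(e <- F) f e).+1.
pose d k := k \in map f F.
pose c k := `[< exists2 e, f e = k & b e >].
have cf e : c (f e) = b e.
  apply/asboolP/idP => [[e' /f_inj ->]//|be]; by exists e.
have fN e : e \in F -> (f e < N)%N.
  by move=> eF; rewrite ltnS; exact: leq_bigmax_seq.
rewrite (_ : _ `&` _ = cyl N d c).
  rewrite cyl_measure -(big_mkord d (fun k => wt (c k))) -big_filter; congr _%:E.
  rewrite (perm_big (map f F)); last first.
    apply: uniq_perm.
    - by rewrite filter_uniq// iota_uniq.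
    - by rewrite map_inj_uniq// fset_uniq.
    - move=> k; rewrite mem_filter mem_index_iota /= /d.
      by apply: andb_idr => /mapP[e eF ->]; exact: fN.
  by rewrite big_map; apply: eq_bigr => e _; rewrite cf.
congr (_ `&` _); apply/seteqP; split=> x /= h.
  by move=> k kN /mapP[e eF ->]; rewrite cf; exact: h.
by move=> e eF; rewrite /expand h ?cf ?fN//; exact: map_f.
Qed.

End BernoulliExistence.

Lemma bernoulliP (R : realType) (E : choiceType) (p : R) :
  countable [set: E] -> 0 <= p <= 1 -> is_bernoulli p (bernoulli E p).
Proof.
move=> /countable_injP[f f_inj] p01.
have f_inj' : injective f by move=> x y; apply: f_inj; rewrite inE.
have [P hP] := bernoulli_existence p01 f_inj'.
exact: (getI hP).
Qed.

(** * Bond percolation *)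

(** Parallel edges and loops are allowed; the two ends of an edge are listed in
   an arbitrary order. *)
Record multigraph := Multigraph {
  vertex : choiceType ;
  edge : choiceType ;
  ends : edge -> vertex * vertex }.

Section Percolation.
Variables (R : realType) (X : multigraph) (o : vertex X).

Definition open_adj (w : config (edge X)) (u v : vertex X) : Prop :=
  exists2 e, w e & ends e = (u, v) \/ ends e = (v, u).

Definition cluster (w : config (edge X)) : set (vertex X) :=
  [set v | clos_refl_trans _ (open_adj w) o v].

Definition theta (p : R) : \bar R :=
  bernoulli (edge X) p [set w | infinite_set (cluster w)].

Definition critical_probability : R :=
  inf [set p : R | 0 <= p <= 1 /\ (0 < theta p)%E].

Definition mean_cluster_size (p : R) : \bar R :=
  (\int[bernoulli (edge X) p]_w counting (cluster w))%E.

End Percolation.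

(** * Cayley graphs *)

Section Cayley.
Variable G : groupType.

(** The edge indexed by [(g, s)] joins [g] to [g * s]. *)
Definition cayley (S : set G) : multigraph :=
  @Multigraph G (G * S)%type (fun e => (e.1, (e.1 * val e.2)%g)).

Definition generates (S : set G) : Prop :=
  smallest (fun H : set G => group_closed (mem H)) S = setT.

End Cayley.

Definition fp_gens (I : choiceType) (G : I -> groupType)
    (S : forall i, set (G i)) : set (free_product G) :=
  \bigcup_(i in setT) (fp_in i @` S i).

(* Main.v *)
(* Write [chi_i] for the mean cluster size in [G_i] and [f = sum_i (1 - 1/chi_i)];
   the equation of the theorem says that all [chi_i] are finite and [f(p) = 1].
   The cosets of the factors are glued together like a tree, so the cluster of
   the origin is a multitype branching process in which a vertex entered through
   a copy of [G_i] has mean offspring [chi_j - 1] of each type [j <> i]. With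
   respect to the weights [1/chi_i] this mean matrix is subcritical if [f < 1]
   and supercritical if [f > 1].

   - If [f(p) < 1], the probability of reaching a reduced word is at most the
     product over its letters of the connection probabilities in the factors;
     summing over words bounds the mean cluster size by [1/(1 - f(p))].
   - If [f(p) > 1], this already holds for finitely many letters and open paths of
     bounded length, and a second moment estimate shows by induction that the
     survival probabilities of the truncated process stay above a multiple of
     [1/chi_i]. The truncated [f] is continuous in [p], so [theta > 0] near [p].

   Hence [f(pc) <= 1]. Finiteness of the mean cluster size of a Cayley graph is an
   open condition on [p] (as in Duminil-Copin and Tassion: it follows from a
   condition on finitely many edges). Applied to the free product itself this
   gives [pc > 0] and [f(pc) >= 1], without any continuity of the [chi_i].
   Uniqueness holds because the [chi_i] are strictly increasing where finite. *)
From Stdlib Require Import Relation_Operators.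
From mathcomp Require Import all_boot all_order all_algebra finmap.
From mathcomp Require Import all_classical all_reals all_analysis measurable_realfun.
From mathcomp Require Import ring lra.
(* Imported last because mathcomp-analysis also has a [cluster]. *)
Require Import Defs.

Set Implicit Arguments.
Unset Strict Implicit.
Unset Printing Implicit Defensive.

Import Order.TTheory GRing.Theory Num.Theory numFieldNormedType.Exports.
Local Open Scope classical_set_scope.
Local Open Scope ring_scope.

(** * Bernoulli measures *)

Local Notation image_measure :=
  measure_function_pushforward__canonical__measure_function_Measure.

Section Configurations.
Variable E : choiceType.
Implicit Types (A B : set (config E)) (D : set E) (w : config E).

Definition all_open (F : {fset E}) : set (config E) :=
  [set w | forall e, e \in F -> w e].

Lemma measurable_edge e (b : bool) : measurable [set w : config E | w e = b].
Proof.
have mT : measurable [set w : config E | w e].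
  by apply: sub_sigma_algebra; exists e.
case: b => //; rewrite (_ : [set _ | _] = ~` [set w : config E | w e]).
  exact: measurableC.
by apply/seteqP; split=> w /= => [->//|/negP/negbTE].
Qed.

Lemma measurable_all_open F : measurable (all_open F).
Proof.
rewrite (_ : all_open F = \bigcap_(e in [set` F]) [set w : config E | w e]).
  by apply: fin_bigcap_measurable => // e _; exact: measurable_edge.
by apply/seteqP; split => w /= h e; exact: h.
Qed.

Lemma measurable_config d (T : measurableType d) (f : T -> config E) :
  (forall e, measurable [set t | f t e]) -> measurable_fun setT f.
Proof.
move=> h; apply: (@measurability _ _ _ _ setT f (@edge_events E)) => //.
by move=> _ [_ [e _ <-] <-]; rewrite setTI; exact: h.
Qed.

Lemma measurable_preim_config d (T : measurableType d) (f : T -> config E) A :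
  (forall e, measurable [set t | f t e]) -> measurable A -> measurable (f @^-1` A).
Proof.
by move=> h mA; rewrite -[X in measurable X]setTI; exact: measurable_config.
Qed.

(** The events [all_open F] are stable under intersection and generate the product sigma-algebra, so
    the uniqueness theorem for measures on a pi-system applies. *)
Lemma finite_measure_eq (R : realType)
    (m1 m2 : {measure set (config E) -> \bar R}) :
  (m1 setT < +oo)%E -> (forall F, m1 (all_open F) = m2 (all_open F)) ->
  forall A, measurable A -> m1 A = m2 A.
Proof.
move=> fin1 eq12 A mA.
apply: (@g_sigma_algebra_measure_unique _ R (config E) (range all_open) _ (fun=> setT)) => //.
- by move=> _ [F _ <-]; exact: measurable_all_open.
- by move=> _; exists fset0 => //; apply/seteqP; split.
- by rewrite bigcup_const//; exists 0%N.
- move=> _ _ [F1 _ <-] [F2 _ <-]; exists (F1 `|` F2)%fset => //.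
  apply/seteqP; split => [w h|w [h1 h2] e].
    by split=> e eF; apply: h; rewrite in_fsetU eF ?orbT.
  by rewrite in_fsetU => /orP[]; [exact: h1|exact: h2].
- by move=> _ [F _ <-].
apply: (smallest_sub (smallest_sigma_algebra _ _)) mA => _ [e _ <-].
apply: sub_sigma_algebra; exists [fset e]%fset => //.
by apply/seteqP; split=> w /= => [/(_ e (fset11 e))|h _ /fset1P ->].
Qed.

(** Dependence is a statement about configurations rather than about a sub-sigma-algebra, so it can
    be checked by pathwise arguments; for measurable events it yields independence through
    [prob_indep]. *)
Definition depends D A := forall w w', (forall e, D e -> w e = w' e) -> A w -> A w'.

Lemma depends_sub D D' A : D `<=` D' -> depends D A -> depends D' A.
Proof. by move=> DD' dA w w' h; apply: dA => e /DD'; exact: h. Qed.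

Lemma dependsI D A B : depends D A -> depends D B -> depends D (A `&` B).
Proof. by move=> dA dB w w' h [Aw Bw]; split; [exact: dA Aw|exact: dB Bw]. Qed.

Lemma depends_bigcup (T : Type) (P : set T) D (A : T -> set (config E)) :
  (forall t, P t -> depends D (A t)) -> depends D (\bigcup_(t in P) A t).
Proof. by move=> dA w w' h [t Pt At]; exists t => //; exact: dA At. Qed.

Definition mask D (w : config E) : config E := fun e => w e && `[< D e >].

Lemma measurable_mask D e : measurable [set w | mask D w e].
Proof.
rewrite /mask; case: asboolP => De.
  rewrite (_ : [set _ | _] = [set w | w e = true]); first exact: measurable_edge.
  by apply/seteqP; split=> w /=; rewrite andbT.
rewrite (_ : [set _ | _] = set0) //.
by apply/seteqP; split=> w //=; rewrite andbF.
Qed.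

Lemma depends_mask D A : depends D A -> A = mask D @^-1` A.
Proof.
move=> dA; apply/seteqP; split=> w /=; apply: dA => e De; rewrite /mask;
  by case: asboolP; rewrite ?andbT.
Qed.

Lemma mask_depends D D' A : depends D' A -> depends (D `&` D') (mask D @^-1` A).
Proof.
move=> dA w w' h; apply: dA => e De; rewrite /mask.
by case: asboolP => De'; rewrite ?andbF// h.
Qed.

Definition set_edge (e : E) (b : bool) (w : config E) : config E :=
  fun e' => if e' == e then b else w e'.

Lemma measurable_set_edge e b A : measurable A -> measurable (set_edge e b @^-1` A).
Proof.
apply: measurable_preim_config => e'; rewrite /set_edge; case: eqP => _.
  by case: b; [rewrite (_ : [set _ | _] = setT)|rewrite (_ : [set _ | _] = set0)];
    rewrite //; apply/seteqP; split.
exact: measurable_edge.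
Qed.

Lemma depends_set_edge D e b A :
  depends D A -> depends (D `\ e) (set_edge e b @^-1` A).
Proof.
move=> dA w w' h; apply: dA => e' De'; rewrite /set_edge.
by case: eqP => // ne; apply: h.
Qed.

Lemma set_edge_split e A :
  A = ([set w | w e = true] `&` (set_edge e true @^-1` A)) `|`
      ([set w | w e = false] `&` (set_edge e false @^-1` A)).
Proof.
have E0 w : set_edge e (w e) w = w.
  by apply/funext => e'; rewrite /set_edge; case: eqP => [->|].
apply/seteqP; split=> w.
  by move=> Aw; case: (boolP (w e)) => [we|/negbTE we]; [left|right];
    split=> //=; rewrite -we E0.
by case=> -[/= we]; rewrite -we E0.
Qed.

(** Induction on the list, fixing the state of one edge at a time; an event that depends on no edge
    is empty or the whole space. *)
Lemma measurable_finite_depends (l : seq E) A : depends [set` l] A -> measurable A.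
Proof.
elim: l A => [|e l IH] A dA.
  have [[w Aw]|A0] := pselect (exists w, A w).
    rewrite (_ : A = setT)//; apply/seteqP; split=> // w' _.
    by apply: dA Aw.
  rewrite (_ : A = set0)//; apply/seteqP; split=> // w Aw.
  by apply: A0; exists w.
have dS b : depends [set` l] (set_edge e b @^-1` A).
  apply: (depends_sub _ (depends_set_edge dA)) => e' [/=].
  by rewrite in_cons => /orP[/eqP|].
rewrite (set_edge_split e A).
by apply: measurableU; apply: measurableI; first [exact: measurable_edge|exact: (IH _ (dS _))].
Qed.

Definition increasing A := forall w w', (forall e, w e -> w' e) -> A w -> A w'.

Lemma increasing_set_edge e b A : increasing A -> increasing (set_edge e b @^-1` A).
Proof. by move=> iA w w' h; apply: iA => e'; rewrite /set_edge; case: eqP => // _; exact: h. Qed.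

End Configurations.

(** * Independence, conditioning on one edge and dependence on the parameter *)

Section Probability.
Variables (R : realType) (E : choiceType).
Hypothesis cE : countable [set: E].
Implicit Types (A B : set (config E)) (D : set E) (p q : R).

Definition prob p A : R := fine (bernoulli E p A).

Lemma probE p A : measurable A -> bernoulli E p A = (prob p A)%:E.
Proof.
move=> mA; rewrite /prob fineK//; apply: fin_num_measure.
exact: mA.
Qed.

Lemma prob_ge0 p A : 0 <= prob p A.
Proof. by rewrite /prob fine_ge0// measure_ge0. Qed.

Lemma prob_le1 p A : measurable A -> prob p A <= 1.
Proof. by move=> mA; rewrite -lee_fin -probE// probability_le1. Qed.

Lemma prob_setT p : prob p setT = 1.
Proof. by rewrite /prob probability_setT. Qed.

Lemma prob_set0 p : prob p set0 = 0.
Proof. by rewrite /prob measure0. Qed.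

Lemma prob_le p A B : measurable A -> measurable B -> A `<=` B ->
  prob p A <= prob p B.
Proof.
by move=> mA mB AB; rewrite -lee_fin -!probE//; apply: le_measure; rewrite ?inE.
Qed.

Lemma prob_setU p A B : measurable A -> measurable B -> A `&` B = set0 ->
  prob p (A `|` B) = prob p A + prob p B.
Proof.
move=> mA mB AB; apply: EFin_inj; rewrite EFinD -!probE//; last exact: measurableU.
by rewrite measureU.
Qed.

Lemma probC p A : measurable A -> prob p (~` A) = 1 - prob p A.
Proof.
move=> mA; have := prob_setU p mA (measurableC mA) (setICr A).
rewrite setUCr prob_setT => ->; ring.
Qed.

Lemma prob_cvg p (F : (set (config E))^nat) : (forall n, measurable (F n)) ->
  nondecreasing_seq F -> prob p (F n) @[n --> \oo] --> prob p (\bigcup_n F n).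
Proof.
move=> mF ndF; have mU : measurable (\bigcup_n F n) by exact: bigcupT_measurable.
pose mu : {measure set (config E) -> \bar R} := bernoulli E p.
have muE A : measurable A -> mu A = (prob p A)%:E by exact: probE.
have := nondecreasing_cvg_mu (mu := mu) mF mU ndF.
rewrite (muE _ mU) (_ : mu \o F = EFin \o (fun n => prob p (F n))).
  exact: fine_cvg.
by apply/funext => n /=; rewrite muE.
Qed.

(** Positivity of the expectation for simple functions. Union and second moment bounds are later
    read off from pointwise inequalities between indicators. *)
Lemma prob_lin p (l : seq (R * set (config E))) :
  (forall x, x \in map snd l -> measurable x) ->
  (forall w, 0 <= \sum_(x <- l) x.1 * \1_(x.2) w) ->
  0 <= \sum_(x <- l) x.1 * prob p x.2.
Proof.
move=> ml h.
(* [Z] stands for an atom of the events already removed from the list and [c] for the sum of their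
   coefficients on it; the next event splits the atom in two. *)
suff H : forall c Z, measurable Z ->
    (forall w, Z w -> 0 <= c + \sum_(x <- l) x.1 * \1_(x.2) w) ->
    0 <= c * prob p Z + \sum_(x <- l) x.1 * prob p (x.2 `&` Z).
  have := H 0 setT measurableT; rewrite mul0r add0r.
  under eq_bigr do rewrite setIT.
  by apply=> w _; rewrite add0r.
elim: l ml {h} => [|[a A] l IH] ml c Z mZ h.
  rewrite big_nil addr0; have [[w Zw]|Z0] := pselect (exists w, Z w).
    by have := h _ Zw; rewrite big_nil addr0 => c0; rewrite mulr_ge0// prob_ge0.
  rewrite (_ : Z = set0) ?prob_set0 ?mulr0//.
  by apply/seteqP; split=> // w Zw; apply: Z0; exists w.
have mA : measurable A by apply: ml; rewrite /= in_cons eqxx.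
have {}ml x : x \in [seq i.2 | i <- l] -> measurable x.
  by move=> xl; apply: ml; rewrite /= in_cons xl orbT.
have mZA := measurableI _ _ mA mZ.
have mZA' := measurableI _ _ (measurableC mA) mZ.
have := IH ml (c + a) (A `&` Z) mZA.
have := IH ml c (~` A `&` Z) mZA'.
have splitZ B : measurable B ->
    prob p (B `&` Z) = prob p (B `&` (A `&` Z)) + prob p (B `&` (~` A `&` Z)).
  move=> mB; rewrite -prob_setU; try exact: measurableI.
    by rewrite -setIUr -setIUl setUCr setTI.
  by apply/seteqP; split=> // w [[_ [wA _]] [_ [wA' _]]].
move=> /(_ _)/wrap[|H1].
  move=> w [nA Zw]; have := h _ Zw; rewrite big_cons /= indicE memNset//.
  by rewrite mulr0 add0r.
move=> /(_ _)/wrap[|H2].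
  move=> w [nA Zw]; have := h _ Zw; rewrite big_cons /= indicE mem_set//.
  by rewrite mulr1 addrA.
rewrite big_cons /=.
have -> : \sum_(x <- l) x.1 * prob p (x.2 `&` Z) =
    \sum_(x <- l) x.1 * prob p (x.2 `&` (A `&` Z)) +
    \sum_(x <- l) x.1 * prob p (x.2 `&` (~` A `&` Z)).
  rewrite -big_split/=; apply: eq_big_seq => x xl.
  by rewrite -mulrDr -splitZ//; apply: ml; exact: map_f.
have := splitZ setT measurableT; rewrite !setTI => ->.
move: H1 H2; set s1 := \sum_(_ <- _) _; set s2 := \sum_(_ <- _) _.
by move=> H1 H2; lra.
Qed.

Lemma prob_bigcup_le p (T : eqType) (l : seq T) (B : T -> set (config E)) A :
  measurable A -> (forall t, t \in l -> measurable (B t)) ->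
  (forall w, A w -> exists2 t, t \in l & B t w) ->
  prob p A <= \sum_(t <- l) prob p (B t).
Proof.
move=> mA mB AB.
have := @prob_lin p ((-1, A) :: [seq (1, B t) | t <- l]).
rewrite big_cons big_map /= mulN1r.
under eq_bigr do rewrite mul1r.
rewrite addrC subr_ge0; apply.
  move=> x; rewrite in_cons -map_comp => /orP[/eqP->//|/mapP[t tl ->]].
  exact: mB.
move=> w; rewrite big_cons big_map /= mulN1r addrC subr_ge0.
rewrite [leLHS]indicE; case: (boolP (w \in A)) => [|_]; last first.
  by apply: sumr_ge0 => t _; rewrite mul1r.
rewrite inE => /AB[t tl Bt].
rewrite (big_rem t)//= indicE mem_set// mulr1 lerDl.
by apply: sumr_ge0 => t' _; rewrite mul1r.
Qed.

Section Fixed.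
Variable p : R.
Hypothesis p01 : 0 <= p <= 1.

Lemma prob_all_open (F : {fset E}) : prob p (all_open F) = \prod_(e <- F) p.
Proof.
apply: EFin_inj; rewrite -probE; last exact: measurable_all_open.
exact: (bernoulliP cE p01 F (fun=> true)).
Qed.

Lemma prob_edge e : prob p [set w | w e = true] = p.
Proof.
transitivity (prob p (all_open [fset e]%fset)); last first.
  by rewrite prob_all_open big_seq_fset1.
congr (prob _ _).
by apply/seteqP; split=> w /= h; [move=> _ /fset1P ->|exact: (h e (fset11 e))].
Qed.

Lemma prob_edgeN e : prob p [set w | w e = false] = 1 - p.
Proof.
transitivity (1 - prob p [set w | w e = true]); last by rewrite prob_edge.
rewrite -probC; last exact: measurable_edge.
by congr (prob _ _); apply/seteqP; split=> w /=; case: (w e).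
Qed.

Lemma prob_all_closed (F : {fset E}) :
  prob p [set w | forall e, e \in F -> w e = false] = \prod_(e <- F) (1 - p).
Proof.
apply: EFin_inj; rewrite -probE; first exact: (bernoulliP cE p01 F (fun=> false)).
apply: (@measurable_finite_depends _ F) => w w' h h' e eF.
by rewrite -h// h'.
Qed.

(** An event that depends on [D] is its own preimage under [mask D], so the product formula is an
    equality of two measures pushed forward by [mask D], to be checked on cylinders. This reduces
    [A] to a cylinder, and then [B]. *)
Lemma prob_indep D D' A B : measurable A -> measurable B ->
  depends D A -> depends D' B -> D `&` D' = set0 ->
  prob p (A `&` B) = prob p A * prob p B.
Proof.
move=> mA mB dA dB DD.
have mM D0 : measurable_fun [set: config E] (mask D0).
  by apply: measurable_config => e; exact: measurable_mask.
have key D1 (m : set (config E)) : measurable m ->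
    (forall F, prob p (mask D1 @^-1` (all_open F) `&` m) =
               prob p (mask D1 @^-1` (all_open F)) * prob p m) ->
    forall C, measurable C -> depends D1 C -> prob p (C `&` m) = prob p C * prob p m.
  move=> mm hF C mC dC.
  have mpre C' : measurable C' -> measurable (mask D1 @^-1` C').
    by move=> mC'; rewrite -[X in measurable X]setTI; exact: mM.
  pose r : {nonneg R} := NngNum (prob_ge0 p m).
  pose m1 : {measure set (config E) -> \bar R} :=
    image_measure (mrestr (bernoulli E p) mm) (mM D1).
  pose m2 : {measure set (config E) -> \bar R} :=
    mscale r (image_measure (bernoulli E p) (mM D1)).
  have e12 : forall C', measurable C' -> m1 C' = m2 C'.
    apply: finite_measure_eq.
      rewrite /m1 /= /pushforward /mrestr preimage_setT setTI.
      by rewrite (probE p mm) ltry.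
    move=> F; rewrite /m1 /m2 /= /mscale /= /pushforward /mrestr/=.
    have mF := mpre _ (measurable_all_open F).
    rewrite (probE p mF) probE; last exact: measurableI.
    by rewrite hF -EFinM mulrC.
  have := e12 _ mC; rewrite /m1 /m2 /= /mscale /= /pushforward /mrestr/=.
  rewrite -(depends_mask dC) (probE p mC) probE; last exact: measurableI.
  by rewrite -EFinM => -[->]; rewrite mulrC.
have preF D1 F : mask D1 @^-1` (all_open F) =
    if `[< [set` F] `<=` D1 >] then all_open F else set0.
  case: asboolP => FD; apply/seteqP; split=> w //=.
  - by move=> h e eF; have := h e eF; rewrite /mask => /andP[].
  - move=> h e eF; rewrite /mask h//=; apply/asboolP; exact: FD.
  - move=> h; apply: FD => e /= eF; have := h e eF.
    by rewrite /mask => /andP[_ /asboolP].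
have mAO F : measurable (all_open F) by exact: measurable_all_open.
apply: (key D) => // F; rewrite preF; case: asboolP => FD; last first.
  by rewrite set0I prob_set0 mul0r.
rewrite setIC mulrC; apply: (key D') => // F'; rewrite preF.
case: asboolP => FD'; last by rewrite set0I prob_set0 mul0r.
have -> : all_open F' `&` all_open F = all_open (F' `|` F)%fset.
  apply/seteqP; split => [w [h1 h2] e|w h].
    by rewrite in_fsetU => /orP[]; [exact: h1|exact: h2].
  by split=> e eF; apply: h; rewrite in_fsetU eF ?orbT.
rewrite !prob_all_open; rewrite -big_cat/=; apply: perm_big.
apply: uniq_perm; rewrite ?fset_uniq ?cat_uniq ?fset_uniq/= ?andbT//.
  apply/hasPn => e eF; apply/negP => eF'.
  have : (D `&` D') e by split; [exact: FD|exact: FD'].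
  by rewrite DD.
by move=> e; rewrite mem_cat in_fsetU.
Qed.

Lemma prob_split e A : measurable A ->
  prob p A = p * prob p (set_edge e true @^-1` A)
       + (1 - p) * prob p (set_edge e false @^-1` A).
Proof.
move=> mA; rewrite {1}(set_edge_split e A) prob_setU.
- have dA b : depends (~` [set e]) (set_edge e b @^-1` A).
    apply: (@depends_sub _ (setT `\ e)); first by move=> e' [].
    by apply: depends_set_edge => w w' h; rewrite (_ : w = w')//; apply/funext => e'; exact: h.
  have de b : depends [set e] [set w : config E | w e = b] by move=> w w' /= <-.
  by rewrite !(prob_indep (measurable_edge _ _) _ (de _) (dA _)) ?setICr//;
    rewrite ?prob_edge ?prob_edgeN//; exact: measurable_set_edge.
- by apply: measurableI; [exact: measurable_edge|exact: measurable_set_edge].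
- by apply: measurableI; [exact: measurable_edge|exact: measurable_set_edge].
- by apply/seteqP; split=> // w [[/= -> _] []].
Qed.

End Fixed.

(** Conditioning on one edge at a time builds the probability from [p] and [1 - p]. All continuity
    in [p] used later comes from here. *)
Lemma finite_depends_poly (l : seq E) A : depends [set` l] A ->
  exists Q : {poly R}, forall p, 0 <= p <= 1 -> prob p A = Q.[p].
Proof.
elim: l A => [|e l IH] A dA.
  have [[w Aw]|A0] := pselect (exists w, A w).
    exists 1 => p _; rewrite hornerE (_ : A = setT) ?prob_setT//.
    by apply/seteqP; split=> // w' _; apply: dA Aw.
  exists 0 => p _; rewrite hornerE (_ : A = set0) ?prob_set0//.
  by apply/seteqP; split=> // w Aw; apply: A0; exists w.
have dS b : depends [set` l] (set_edge e b @^-1` A).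
  apply: (depends_sub _ (depends_set_edge dA)) => e' [/=].
  by rewrite in_cons => /orP[/eqP|].
have [Q1 h1] := IH _ (dS true); have [Q0 h0] := IH _ (dS false).
exists ('X * Q1 + (1 - 'X) * Q0) => p p01.
rewrite (prob_split p01 e (measurable_finite_depends dA)) h1// h0//.
by rewrite !hornerE.
Qed.

(** Conditioning on one edge at a time replaces a coupling of the two measures: opening an edge can
    only raise the conditional probability. *)
Lemma prob_increasing_le (l : seq E) A p q : depends [set` l] A -> increasing A ->
  0 <= p -> p <= q -> q <= 1 -> prob p A <= prob q A.
Proof.
move=> dA iA p0 pq q1.
have p01 : 0 <= p <= 1 by rewrite p0 (le_trans pq).
have q01 : 0 <= q <= 1 by rewrite q1 (le_trans p0).
elim: l A dA iA => [|e l IH] A dA iA.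
  have [[w Aw]|A0] := pselect (exists w, A w).
    rewrite (_ : A = setT) ?prob_setT//.
    by apply/seteqP; split=> // w' _; apply: dA Aw.
  rewrite (_ : A = set0) ?prob_set0//.
  by apply/seteqP; split=> // w Aw; apply: A0; exists w.
have dS b : depends [set` l] (set_edge e b @^-1` A).
  apply: (depends_sub _ (depends_set_edge dA)) => e' [/=].
  by rewrite in_cons => /orP[/eqP|].
have mA := measurable_finite_depends dA.
rewrite (prob_split p01 e mA) (prob_split q01 e mA).
have h1 := IH _ (dS true) (increasing_set_edge iA).
have h0 := IH _ (dS false) (increasing_set_edge iA).
have h : prob q (set_edge e false @^-1` A) <= prob q (set_edge e true @^-1` A).
  apply: prob_le; try exact: measurable_set_edge.
  by move=> w; apply: iA => e'; rewrite /set_edge; case: eqP.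
nra.
Qed.

End Probability.

(** As [phi] is injective, both laws give the same power of [p] to a finite set of open edges. This
    supplies translation invariance, and lets a copy of a factor inside the free product be treated
    as the factor itself. *)
Lemma prob_push (R : realType) (E E' : choiceType) (p : R) (phi : E' -> E) A :
  countable [set: E] -> countable [set: E'] -> 0 <= p <= 1 -> injective phi ->
  measurable A ->
  prob p [set w : config E | A (w \o phi : config E')] = prob p A.
Proof.
move=> cE cE' p01 phi_inj mA.
pose f (w : config E) : config E' := w \o phi.
have mf : measurable_fun [set: config E] f.
  by apply: measurable_config => e; exact: measurable_edge.
have mpre C : measurable C -> measurable (f @^-1` C).
  by move=> mC; rewrite -[X in measurable X]setTI; exact: mf.
apply: EFin_inj; rewrite -!probE//; last exact: mpre.
pose m1 : {measure set (config E') -> \bar R} := image_measure (bernoulli E p) mf.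
pose m2 : {measure set (config E') -> \bar R} := bernoulli E' p.
suff e12 : forall C, measurable C -> m1 C = m2 C by exact: e12.
apply: finite_measure_eq.
  by rewrite /m1 /= /pushforward preimage_setT probability_setT ltry.
move=> F; rewrite /m1 /m2 /= /pushforward.
have mF := measurable_all_open F.
rewrite !probE//; last exact: mpre.
rewrite (_ : f @^-1` _ = all_open [fset phi e | e in F]%fset).
  rewrite !prob_all_open//; congr EFin.
  by rewrite big_imfset//= => x y _ _; exact: phi_inj.
apply/seteqP; split=> w h e.
  by move=> /imfsetP[e' /= e'F ->]; exact: h.
by move=> eF; apply: h; apply/imfsetP; exists e.
Qed.

(** * Open paths and mean cluster sizes *)

Section Reach.
Variable X : multigraph.
Implicit Types (w : config (edge X)) (u v : vertex X).

(** A step may stay in place, so this means an open path of length at most [n], and it is monotone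
    in [n]. In a locally finite graph it depends on finitely many edges, unlike [cluster]. *)
Fixpoint reach w n u v : Prop :=
  if n is n'.+1 then exists2 u', u = u' \/ open_adj w u u' & reach w n' u' v
  else u = v.

Lemma reachxx w n u : reach w n u u.
Proof. by elim: n => //= n IH; exists u; [left|]. Qed.

Lemma reachS w n u v : reach w n u v -> reach w n.+1 u v.
Proof. by move=> r; exists u; [left|]. Qed.

Lemma reach_leq w m n u v : (m <= n)%N -> reach w m u v -> reach w n u v.
Proof.
by move=> /subnK <-; elim: (n - m)%N => // k IH r; rewrite addSn; exact/reachS/IH.
Qed.

Lemma reach_trans w m n u v x :
  reach w m u v -> reach w n v x -> reach w (m + n) u x.
Proof.
elim: m u => [u /= ->//|m IH u [u' uu' r] r'].
by rewrite addSn; exists u' => //; exact: IH.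
Qed.

Lemma open_adj_sym w u v : open_adj w u v -> open_adj w v u.
Proof. by move=> [e we ee]; exists e => //; case: ee; [right|left]. Qed.

Lemma clusterP w u v : cluster u w v <-> exists n, reach w n u v.
Proof.
split.
  elim=> {u v} [u v uv|u|u v x _ [m r] _ [n r']].
  - by exists 1%N; exists v; [right|].
  - by exists 0%N.
  - by exists (m + n)%N; exact: reach_trans r'.
case=> n; elim: n u => [u ->|n IH u [u' uu' /IH r]]; first exact: rt_refl.
case: uu' => [->//|uu']; apply: rt_trans r; exact: rt_step.
Qed.

Lemma increasing_reach n u v : increasing [set w | reach w n u v].
Proof.
move=> w w' h /=; elim: n u => //= n IH u [u' uu' /IH r]; exists u' => //.
case: uu' => [->|[e we ee]]; [by left|right; exists e => //; exact: h].
Qed.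

Lemma reach_isolated w n u v :
  (forall e, (ends e).1 = u \/ (ends e).2 = u -> w e = false) ->
  reach w n u v -> v = u.
Proof.
move=> h; elim: n => [//|n IH] /= [u' [<- /IH//|[e we ee]] _].
by move: we; rewrite h//; case: ee => ->; [left|right].
Qed.

Definition locally_finite := forall u, exists l : seq (edge X),
  forall e, (ends e).1 = u \/ (ends e).2 = u -> e \in l.

Hypothesis lfX : locally_finite.

Lemma reach_finite_depends n u v :
  exists l : seq (edge X), depends [set` l] [set w | reach w n u v].
Proof.
elim: n u => [|n IH] u; first by exists [::] => w w' _.
have [L hL] := choice IH; have [l hl] := lfX u.
exists (l ++ L u ++ flatten [seq L (ends e).1 ++ L (ends e).2 | e <- l]).
move=> w w' h /= [u' uu' r].
case: uu' => [uu'|[e we ee]].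
  exists u'; first by left.
  apply: (hL u' w) r => e /= eL; apply: h; rewrite /= !mem_cat.
  by rewrite uu' eL orbT.
have el : e \in l by apply: hl; case: ee => ->; [left|right].
exists u'.
  right; exists e => //; rewrite -h//=.
  by rewrite mem_cat el.
apply: (hL u' w) r => e' /= eL; apply: h; rewrite /= !mem_cat.
apply/orP; right; apply/orP; right; apply/flattenP.
exists (L (ends e).1 ++ L (ends e).2).
  exact: map_f.
by rewrite mem_cat; case: ee => -> /=; rewrite eL ?orbT.
Qed.

Lemma measurable_reach n u v : measurable [set w | reach w n u v].
Proof.
have [l hl] := reach_finite_depends n u v.
exact: measurable_finite_depends hl.
Qed.

Lemma connectedE u v :
  [set w | cluster u w v] = \bigcup_n [set w | reach w n u v].
Proof.
apply/seteqP; split=> w /=; first by move/clusterP => [n r]; exists n.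
by move=> [n _ r]; apply/clusterP; exists n.
Qed.

Lemma measurable_connected u v : measurable [set w | cluster u w v].
Proof.
by rewrite connectedE; apply: bigcupT_measurable => n; exact: measurable_reach.
Qed.

End Reach.

(** Used for translations, embeddings, projections and retractions; the map may collapse an open
    edge because paths may stay in place. *)
Lemma reach_sim (X Y : multigraph) (w : config (edge X)) (w' : config (edge Y))
    (f : vertex X -> vertex Y) :
  (forall u u', open_adj w u u' -> f u = f u' \/ open_adj w' (f u) (f u')) ->
  forall n u v, reach w n u v -> reach w' n (f u) (f v).
Proof.
move=> h; elim=> [u v /= ->//|n IH u v [u' uu' /IH r]].
exists (f u') => //; case: uu' => [->|/h//]; by left.
Qed.

Lemma ler_sum_sub (R : numDomainType) (T : eqType) (s t : seq T) (F : T -> R) :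
  uniq s -> {subset s <= t} -> (forall x, 0 <= F x) ->
  \sum_(x <- s) F x <= \sum_(x <- t) F x.
Proof.
move=> us st F0; elim: s t us st => [|x s IH] t; first by rewrite big_nil sumr_ge0.
move=> /= /andP[xs us] st; have xt : x \in t by apply: st; rewrite mem_head.
rewrite (perm_big _ (perm_to_rem xt)) !big_cons lerD2l; apply: IH => // y ys.
apply: rem_mem; first by apply: contraNneq xs => <-.
by apply: st; rewrite in_cons ys orbT.
Qed.

(** * Two-point functions and the mean cluster size *)

Section MeanClusterSize.
Variables (R : realType) (X : multigraph).
Hypothesis lfX : locally_finite X.
Hypothesis cV : countable [set: vertex X].
Implicit Types (w : config (edge X)) (u v : vertex X) (p : R).

(** The two-point function; in [tauN] only open paths of length at most [n] count. *)
Definition tau p u v : R := prob p [set w | cluster u w v].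
Definition tauN p n u v : R := prob p [set w | reach w n u v].

Lemma tau_ge0 p u v : 0 <= tau p u v. Proof. exact: prob_ge0. Qed.
Lemma tauN_nd p u v : nondecreasing_seq (fun n => tauN p n u v).
Proof.
move=> m n mn; apply: prob_le; try exact: measurable_reach.
by move=> w; exact: reach_leq.
Qed.

Lemma tauN_cvg p u v : tauN p n u v @[n --> \oo] --> tau p u v.
Proof.
rewrite /tau connectedE; apply: prob_cvg => [n|m n mn]; first exact: measurable_reach.
by apply/subsetPset => w; exact: reach_leq.
Qed.

Lemma tauN_le p n u v : tauN p n u v <= tau p u v.
Proof.
apply: prob_le; [exact: measurable_reach|exact: measurable_connected|].
by move=> w /= r; apply/clusterP; exists n.
Qed.

Lemma tau_le p u v c : (forall n, tauN p n u v <= c) -> tau p u v <= c.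
Proof.
move=> h; rewrite -(cvg_lim _ (@tauN_cvg p u v))//; apply: limr_le.
  by apply/cvg_ex; exists (tau p u v); exact: tauN_cvg.
exact: nearW.
Qed.

Lemma sum_tau_le p u (F : seq (vertex X)) c :
  (forall n, \sum_(v <- F) tauN p n u v <= c) -> \sum_(v <- F) tau p u v <= c.
Proof.
move=> h; have cv : \sum_(v <- F) tauN p n u v @[n --> \oo] --> \sum_(v <- F) tau p u v.
  by apply: cvg_big => [|v _]; [exact: add_continuous|exact: tauN_cvg].
rewrite -(cvg_lim _ cv)//; apply: limr_le; last exact: nearW.
by apply/cvg_ex; eexists; exact: cv.
Qed.

Variable o : vertex X.

Let enum_fun : exists2 f : vertex X -> nat, injective f &
  forall N, exists F : {fset vertex X}, forall v, (v \in F) = (f v < N)%N.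
Proof.
have /countable_injP[f f_inj] := cV; have f_inj' : injective f.
  by move=> x y; apply: f_inj; rewrite inE.
exists f => //; elim=> [|N [F hF]]; first by exists fset0.
have [[v fv]|nv] := pselect (exists v, f v = N).
  exists (v |` F)%fset => x; rewrite in_fset1U hF ltnS [in RHS]leq_eqVlt -fv.
  by rewrite (inj_eq f_inj').
exists F => x; rewrite hF ltnS [in RHS]leq_eqVlt; case: eqP => // fx.
by exfalso; apply: nv; exists x.
Qed.

Let f := sval (cid2 enum_fun).
Let f_inj : injective f. Proof. by rewrite /f; case: cid2. Qed.
Let f_fin N : exists F : {fset vertex X}, forall v, (v \in F) = (f v < N)%N.
Proof. by rewrite /f; case: cid2. Qed.

(** The cluster carried over to [nat] by an enumeration of the vertices: its mean size becomes a
    series over [k], and its infiniteness the upper limit of the events [S k]. *)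
Let S k : set (config (edge X)) := [set w | (f @` cluster o w) k].

Let SE v : S (f v) = [set w | cluster o w v].
Proof.
apply/seteqP; split=> w /=; last by move=> c; exists v.
by move=> [v' c /f_inj <-].
Qed.

Let S0 k : ~ (exists v, f v = k) -> S k = set0.
Proof.
by move=> h; apply/seteqP; split=> w // [v _ fv]; apply: h; exists v.
Qed.

Let mS k : measurable (S k).
Proof.
have [[v <-]|/S0 ->//] := pselect (exists v, f v = k).
by rewrite SE; exact: measurable_connected.
Qed.

Let partial_sum p N : exists2 F : {fset vertex X}, (forall v, (v \in F) = (f v < N)%N) &
  \sum_(0 <= k < N) prob p (S k) = \sum_(v <- F) tau p o v.
Proof.
elim: N => [|N [F hF sF]].
  by exists fset0 => //; rewrite big_nil big_seq_fset0.
rewrite big_nat_recr//= sF.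
have [[v fv]|nv] := pselect (exists v, f v = N).
  exists (v |` F)%fset => [x|].
    by rewrite in_fset1U hF ltnS [in RHS]leq_eqVlt -fv (inj_eq f_inj).
  rewrite big_fsetU1 ?hF ?fv ?ltnn//= addrC; congr (_ + _).
  by rewrite -fv SE.
exists F => [x|]; last by rewrite S0// prob_set0 addr0.
rewrite hF ltnS [in RHS]leq_eqVlt; case: eqP => // fx.
by exfalso; apply: nv; exists x.
Qed.

Let infiniteE w : infinite_set (cluster o w) <->
  forall N, exists2 k, (N <= k)%N & (f @` cluster o w) k.
Proof.
split=> [inf N|h fin].
  apply/not_exists2P => h; apply: inf.
  have [F hF] := f_fin N; apply: (sub_finite_set _ (finite_fset F)) => v cv /=.
  rewrite hF ltnNge; apply/negP => Nv.
  by have := h (f v) => -[]//; apply; exists v.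
have finI := finite_image f fin.
pose M := \max_(k <- fset_set (f @` cluster o w)) k.
have [k Mk fk] := h M.+1.
suff : (k <= M)%N by rewrite leqNgt Mk.
by apply: (leq_bigmax_seq (F := id)) => //; rewrite in_fset_set// inE.
Qed.

Let counting_image w :
  counting (cluster o w) = counting (f @` cluster o w) :> \bar R.
Proof.
have fin : finite_set (f @` cluster o w) <-> finite_set (cluster o w).
  split; last exact: finite_image.
  move=> finI; apply: contrapT => /infiniteE h.
  have /infiniteE : forall N, exists2 k, (N <= k)%N & (f @` cluster o w) k by [].
  pose M := \max_(k <- fset_set (f @` cluster o w)) k.
  have [k Mk fk] := h M.+1.
  suff : (k <= M)%N by rewrite leqNgt Mk.
  by apply: (leq_bigmax_seq (F := id)) => //; rewrite in_fset_set// inE.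
rewrite /counting; case: asboolP => fC; case: asboolP => fI //.
- rewrite fset_set_image// card_imfset//.
- by exfalso; apply/fI/fin.
- by exfalso; apply/fC/fin.
Qed.

Lemma mean_cluster_sizeE p :
  mean_cluster_size o p = (\sum_(k <oo) (prob p (S k))%:E)%E.
Proof.
rewrite /mean_cluster_size.
transitivity (\int[bernoulli (edge X) p]_w
    (\sum_(k <oo) (\1_(S k) w)%:E))%E.
  apply: eq_integral => w _; rewrite counting_image counting_dirac.
  by apply: eq_eseriesr => k _; rewrite /dirac !indicE.
rewrite integral_nneseries//.
  apply: eq_eseriesr => k _.
  by rewrite integral_indic// setIT; exact: probE.
by move=> k; apply/measurable_EFinP; exact: measurable_indic.
Qed.

Lemma measurable_infinite_cluster :
  measurable [set w | infinite_set (cluster o w)].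
Proof.
rewrite (_ : [set _ | _] = \bigcap_n \bigcup_(k in [set k | (n <= k)%N]) S k).
  by apply: bigcapT_measurable => n; apply: bigcup_measurable.
apply/seteqP; split=> w /=.
  by move=> /infiniteE h n _; have [k nk Sk] := h n; exists k.
by move=> h; apply/infiniteE => N; have [k Nk Sk] := h N I; exists k.
Qed.

Lemma sum_tau_le_mean p (F : {fset vertex X}) :
  ((\sum_(v <- F) tau p o v)%:E <= mean_cluster_size o p)%E.
Proof.
rewrite mean_cluster_sizeE.
pose N := (\max_(v <- F) f v).+1.
have [F' hF' sF'] := partial_sum p N.
apply: (@le_trans _ _ (\sum_(0 <= k < N) (prob p (S k))%:E)%E); last first.
  by apply: nneseries_lim_ge => n _ _; rewrite lee_fin prob_ge0.
rewrite sumEFin sF' lee_fin.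
apply: ler_sum_sub => [|v vF|v]; [exact: fset_uniq| |exact: tau_ge0].
by rewrite hF' ltnS; exact: leq_bigmax_seq.
Qed.

Lemma mean_le p c : (forall F : {fset vertex X}, \sum_(v <- F) tau p o v <= c) ->
  (mean_cluster_size o p <= c%:E)%E.
Proof.
move=> h; rewrite mean_cluster_sizeE; apply: lime_le.
  by apply: is_cvg_nneseries => n _ _; rewrite lee_fin prob_ge0.
apply: nearW => N; have [F _ sF] := partial_sum p N.
by rewrite sumEFin sF lee_fin.
Qed.

(** Borel-Cantelli: the mean cluster size is the sum of the probabilities of the [S k], and an
    infinite cluster meets infinitely many of them. *)
Lemma theta_eq0 p : (mean_cluster_size o p < +oo)%E -> theta o p = 0%E.
Proof.
rewrite mean_cluster_sizeE => fin; rewrite /theta.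
rewrite (_ : [set _ | _] = lim_sup_set S).
  apply: lim_sup_set_cvg0 => //.
  apply: le_lt_trans fin; rewrite le_eqVlt; apply/orP; left; apply/eqP.
  by apply: eq_eseriesr => k _; exact: probE.
apply/seteqP; split=> w /=.
  by move=> /infiniteE h n _; have [k nk Sk] := h n; exists k.
by move=> h; apply/infiniteE => N; have [k Nk Sk] := h N I; exists k.
Qed.

End MeanClusterSize.

(** * Percolation on Cayley graphs *)

Lemma countable_inj (T : Type) (f : T -> nat) : injective f -> countable [set: T].
Proof. by move=> fi; apply/countable_injP; exists f => x y _ _; exact: fi. Qed.

Lemma poly_lt_near (R : realType) (Q : {poly R}) (p c : R) : Q.[p] < c ->
  exists2 eps, 0 < eps & forall q, `|q - p| < eps -> Q.[q] < c.
Proof.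
move=> Qc; have h : Q.[q] @[q --> p] --> Q.[p] by exact: continuous_horner.
have /nbhs_ballP[eps /= e0 he] : \forall q \near p, Q.[q] < c.
  exact: (cvgr_lt _ h).
by exists eps => // q qp; apply: he; rewrite /ball/= distrC.
Qed.

Section CayleyPercolation.
Variables (R : realType) (G : groupType) (S : set G).
Hypothesis finS : finite_set S.
Hypothesis cG : countable [set: G].
Local Notation X := (cayley S).
Implicit Types (w : config (edge X)) (u v x z : G) (p q : R).

Lemma gens_list : exists l : seq S, forall s, s \in l.
Proof.
exists (pmap insub (fset_set S)) => s; rewrite mem_pmap_sub in_fset_set//.
exact: (valP s).
Qed.

Lemma cayley_countable_edge : countable [set: edge X].
Proof.
have /countable_injP[f f_inj] := cG.
have f_inj' : injective f by move=> x y; apply: f_inj; rewrite inE.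
apply: (@countable_inj (G * S) (fun e => choice.pickle (f e.1, f (val e.2)))).
by move=> [u s] [v t] /(pcan_inj choice.pickleK)[/f_inj' -> /f_inj' /val_inj ->].
Qed.

Lemma cayley_locally_finite : locally_finite X.
Proof.
move=> u; have [l hl] := gens_list.
exists ([seq (u, s) | s <- l] ++ [seq ((u * (val s)^-1)%g, s) | s <- l]).
move=> [v s] /= h; rewrite mem_cat; apply/orP; case: h => <-.
  by left; exact: map_f.
by right; apply/mapP; exists s; rewrite ?mulgK.
Qed.

Lemma cayley_neighbours : exists N : {fset G},
  forall w u v, open_adj w u v -> exists2 t, t \in N & v = (u * t)%g.
Proof.
exists (fset_set S `|` [fset s^-1%g | s in fset_set S])%fset => w u v [[x s] _ /=].
have sS : val s \in fset_set S by rewrite in_fset_set//; exact: (valP s).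
case=> -[<- <-].
  by exists (val s); rewrite ?in_fsetU ?sS.
exists (val s)^-1%g; last by rewrite mulgK.
by rewrite in_fsetU; apply/orP; right; apply/imfsetP; exists (val s).
Qed.

Definition translate (g : G) (e : edge X) : edge X := ((g * e.1)%g, e.2).

Lemma translate_inj g : injective (translate g).
Proof. by move=> [x s] [y t] [/mulgI -> ->]. Qed.

Lemma open_adj_translate g w u v :
  open_adj (w \o translate g : config (edge X)) u v -> open_adj w (g * u)%g (g * v)%g.
Proof.
move=> [e we ee]; exists (translate g e) => //.
by case: ee => -[<- <-]; rewrite /= mulgA; [left|right].
Qed.

Lemma reach_translate g w n u v :
  reach (w \o translate g : config (edge X)) n u v <-> reach w n (g * u)%g (g * v)%g.
Proof.
split.
  apply: (@reach_sim X X _ w (fun u : G => (g * u)%g)) => {}u {}v.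
  by move=> /open_adj_translate; right.
rewrite -{2}(mulKg g u) -{2}(mulKg g v).
apply: (@reach_sim X X w _ (fun u : G => (g^-1 * u)%g)).
move=> {}u {}v [e we ee]; right.
exists (translate g^-1 e); first by rewrite /= /translate/= mulVKg; case: e we {ee}.
by case: ee => -[<- <-]; rewrite /= mulgA; [left|right].
Qed.

Lemma tauN_translate p g n u v : 0 <= p <= 1 ->
  tauN (X := X) p n (g * u)%g (g * v)%g = tauN (X := X) p n u v.
Proof.
move=> p01; have cE := cayley_countable_edge.
rewrite /tauN -[RHS](prob_push cE cE p01 (@translate_inj g)); last first.
  exact: (measurable_reach cayley_locally_finite).
by congr (prob _ _); apply/seteqP; split=> w /=; rewrite reach_translate.
Qed.

Lemma tauN_mono p q n u v : 0 <= p -> p <= q -> q <= 1 ->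
  tauN (X := X) p n u v <= tauN (X := X) q n u v.
Proof.
move=> p0 pq q1; have [l hl] := reach_finite_depends cayley_locally_finite n u v.
exact: (prob_increasing_le cayley_countable_edge hl (@increasing_reach X n u v)).
Qed.

Lemma tau_mono p q u v : 0 <= p -> p <= q -> q <= 1 ->
  tau (X := X) p u v <= tau (X := X) q u v.
Proof.
move=> p0 pq q1; apply: (tau_le cayley_locally_finite) => n.
apply: (le_trans (tauN_mono n u v p0 pq q1)).
exact: (tauN_le cayley_locally_finite).
Qed.

(** Condition on the edge from [1] to [s]: if it is open, [s] is reached; if not, [s] is missed at
    least when all edges at the identity are closed. The gap [c] is uniform in [n] so that it passes
    to [tau]. *)
Lemma tauN_gt p q (s : S) : 0 <= p -> p < q -> q <= 1 -> val s != 1%g ->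
  exists2 c, 0 < c & forall n,
    tauN (X := X) p n.+1 1%g (val s) + c <= tauN (X := X) q n.+1 1%g (val s).
Proof.
move=> p0 pq q1 s1; have cE := cayley_countable_edge.
have p01 : 0 <= p <= 1 by rewrite p0 (le_trans (ltW pq)).
have q01 : 0 <= q <= 1 by rewrite q1 (le_trans p0 (ltW pq)).
have [l hl] := cayley_locally_finite 1%g.
pose F := [fset e in l]%fset.
pose closed1 : set (config (edge X)) := [set w | forall e, e \in F -> w e = false].
have dclosed : depends [set` F] closed1.
  by move=> w w' h cw e eF; rewrite -h// cw.
have mclosed := measurable_finite_depends dclosed.
(* If [P <= Q] are the probabilities at [p] and [q] with that edge closed, then [q + (1 - q) Q]
   exceeds [p + (1 - p) P] by at least [(q - p) (1 - P)], and [1 - P] is at least the probability of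
   [closed1]. *)
exists ((q - p) * prob p closed1).
  rewrite mulr_gt0 ?subr_gt0// prob_all_closed// prodr_gt0// => e _.
  by rewrite subr_gt0 (lt_le_trans pq).
move=> n; pose A : set (config (edge X)) := [set w | reach (X := X) w n.+1 1%g (val s)].
pose e0 : edge X := (1%g, s).
have mA : measurable A by exact: (measurable_reach cayley_locally_finite).
have [l' dA] := reach_finite_depends cayley_locally_finite n.+1 1%g (val s).
have iA := @increasing_reach X n.+1 1%g (val s).
pose A0 := set_edge e0 false @^-1` A.
have mA0 : measurable A0 by exact: measurable_set_edge.
have E1 : set_edge e0 true @^-1` A = setT.
  apply/seteqP; split=> // w _ /=; exists (val s); last exact: reachxx.
  right; exists e0; first by rewrite /set_edge eqxx.
  by left; rewrite /= mul1g.
have dA0 : depends [set` l'] A0.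
  by apply: (depends_sub _ (depends_set_edge dA)) => e [].
have iA0 : increasing A0 by exact: increasing_set_edge.
have le0 := prob_increasing_le cE dA0 iA0 p0 (ltW pq) q1.
have cl : prob p A0 <= 1 - prob p closed1.
  rewrite -probC//; apply: prob_le => //; first exact: measurableC.
  move=> w A0w cw; case/eqP: s1; apply: (reach_isolated _ A0w) => e he.
  by rewrite /set_edge; case: eqP => // _; apply: cw; rewrite inE hl.
rewrite /tauN (prob_split cE p01 e0 mA) (prob_split cE q01 e0 mA) E1 !prob_setT.
move: le0 cl; rewrite -/A0; set P := prob p A0; set Q := prob q A0.
set k := prob p closed1 => le0 cl; nra.
Qed.

Lemma tauN_gen_ge p (s : S) : 0 <= p <= 1 -> p <= tauN (X := X) p 1 1%g (val s).
Proof.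
move=> p01; have cE := cayley_countable_edge.
rewrite -{1}(prob_edge cE p01 ((1%g, s) : edge X)); apply: prob_le.
- exact: measurable_edge.
- exact: (measurable_reach cayley_locally_finite).
move=> w we; exists (val s) => //; right; exists (1%g, s) => //.
by left; rewrite /= mul1g.
Qed.

(** At [p = 0] all edges at the identity are almost surely closed. *)
Lemma mean0_lty : (mean_cluster_size (X := X) 1%g (0 : R) < +oo)%E.
Proof.
have lf := cayley_locally_finite; have cE := cayley_countable_edge.
have p01 : 0 <= (0 : R) <= 1 by rewrite lexx ler01.
apply: (@le_lt_trans _ _ 1%:E); last exact: ltry.
apply: (mean_le lf cG) => F; apply: (sum_tau_le lf) => n.
apply: (@le_trans _ _ (\sum_(v <- [:: 1%g : G]) tauN (X := X) 0 n 1%g v)); last first.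
  by rewrite big_seq1; apply: prob_le1; exact: (measurable_reach lf).
rewrite (bigID (pred1 (1%g : G)))/= [X in _ + X]big1 ?addr0 => [|v v1]; last first.
  apply/eqP; rewrite eq_le prob_ge0 andbT.
  have [l hl] := lf 1%g; pose F' := [fset e in l]%fset.
  pose A : set (config (edge X)) := [set w | forall e, e \in F' -> w e = false].
  have mA : measurable A.
    apply: (@measurable_finite_depends _ F') => w w' h h' e eF.
    by rewrite -h// h'.
  have A1 : prob (0 : R) A = 1.
    by rewrite prob_all_closed// big1// => e _; rewrite subr0.
  apply: (@le_trans _ _ (prob 0 (~` A))); last by rewrite probC// A1 subrr.
  apply: prob_le; [exact: (measurable_reach lf)|exact: measurableC|].
  move=> w r Aw; case/eqP: v1; apply: (reach_isolated _ r) => e he.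
  by apply: Aw; rewrite inE hl.
rewrite -big_filter; apply: ler_sum_sub => [|v|v]; last exact: prob_ge0.
  by rewrite filter_uniq// fset_uniq.
by rewrite mem_filter inE => /andP[].
Qed.

(** A strict gain at the single vertex [s] is enough, since all other two-point functions are
    non-decreasing in [p]. *)
Lemma mean_strict p q (s : S) : 0 <= p -> p < q -> q <= 1 -> val s != 1%g ->
  mean_cluster_size (X := X) 1%g q \is a fin_num ->
  fine (mean_cluster_size (X := X) 1%g p) <
  fine (mean_cluster_size (X := X) 1%g q).
Proof.
move=> p0 pq q1 s1; case E : (mean_cluster_size _ q) => [r| |] // _.
have [c c0 hc] := tauN_gt p0 pq q1 s1.
have lf := cayley_locally_finite; have cE := cayley_countable_edge.
have taus : tau (X := X) p 1%g (val s) + c <= tau (X := X) q 1%g (val s).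
  rewrite -lerBrDr; apply: (tau_le lf) => -[|n].
    apply: (@le_trans _ _ (tauN (X := X) p 1 1%g (val s))).
      exact: (tauN_nd lf).
    by rewrite lerBrDr; apply: (le_trans (hc 0%N)); exact: (tauN_le lf).
  by rewrite lerBrDr; apply: (le_trans (hc n)); exact: (tauN_le lf).
have : (mean_cluster_size (X := X) 1%g p <= (r - c)%:E)%E.
  (* Enlarging [F] by [s] makes every partial sum feel the gap [c]. *)
  apply: (mean_le lf cG) => F; pose F' := (val s |` F)%fset.
  apply: (@le_trans _ _ (\sum_(v <- F') tau (X := X) p 1%g v)).
    apply: ler_sum_sub => [|v vF|v]; [exact: fset_uniq| |exact: tau_ge0].
    by rewrite in_fset1U vF orbT.
  have := sum_tau_le_mean lf cG 1%g q F'; rewrite E lee_fin => hr.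
  rewrite lerBrDr; apply: le_trans hr.
  have sF : val s \in F' by rewrite in_fset1U eqxx.
  rewrite !(bigD1_seq (val s) sF (fset_uniq _))/=; rewrite addrAC lerD//.
  by apply: ler_sum => v _; apply: tau_mono => //; exact: ltW.
have : (0 <= mean_cluster_size (X := X) 1%g p)%E.
  have := sum_tau_le_mean lf cG 1%g p fset0.
  by rewrite big_seq_fset0.
case: (mean_cluster_size _ p) => [r'| |] //= _.
by rewrite lee_fin => h; apply: (le_lt_trans h); rewrite gtrBl.
Qed.

End CayleyPercolation.

(** * Finite mean cluster size is an open condition *)

Section FiniteCriterion.
Variables (R : realType) (G : groupType) (S : set G).
Hypothesis finS : finite_set S.
Hypothesis cG : countable [set: G].
Local Notation X := (cayley S).
Local Notation lf := (cayley_locally_finite finS).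
Local Notation cE := (@cayley_countable_edge G S cG).
Implicit Types (w : config (edge X)) (u v x z : G) (p q : R) (B C F : {fset G}).

Definition inner B : set (edge X) := [set e | e.1 \in B /\ (e.1 * val e.2)%g \in B].
Definition outer C : set (edge X) := [set e | e.1 \notin C /\ (e.1 * val e.2)%g \notin C].

Let ends_cases (e : edge X) u v : ends e = (u, v) \/ ends e = (v, u) ->
  u = e.1 /\ v = (e.1 * val e.2)%g \/ v = e.1 /\ u = (e.1 * val e.2)%g.
Proof. by case=> -[<- <-]; [left|right]. Qed.

Definition inner_cluster B w : set G := cluster (X := X) 1%g (mask (inner B) w).

Lemma inner_cluster1 B w : inner_cluster B w 1%g.
Proof. exact: rt_refl. Qed.

Lemma open_adj_inner B w u v : open_adj (mask (inner B) w) u v -> v \in B.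
Proof. by case=> -[x s] /andP[_ /asboolP[/= e1 e2]] /= [] [] => [_ <-|<- _]. Qed.

Lemma inner_cluster_sub B w v : 1%g \in B -> inner_cluster B w v -> v \in B.
Proof.
move=> B1 /clusterP[n].
suff H u : u \in B -> reach (X := X) (mask (inner B) w) n u v -> v \in B by exact: H.
elim: n u => [u uB /= <-//|n IH u uB [u' uu' r]].
by apply: (IH u') => //; case: uu' => [<-//|/open_adj_inner].
Qed.

Lemma inner_finite B : exists l : seq (edge X), inner B `<=` [set` l].
Proof.
have [l hl] := gens_list finS.
exists [seq (x, s) | x <- B, s <- l] => -[x s] [/= xB _].
by apply/allpairsP; exists (x, s); rewrite hl.
Qed.

(** The edges inspected in finding that the inner cluster is [C]. None of them lies in [outer C],
    which makes the remainder of a path independent of this exploration. *)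
Definition touching B C : set (edge X) :=
  [set e | inner B e /\ (e.1 \in C \/ (e.1 * val e.2)%g \in C)].

(** Open edges touching [C] certify that [C] is connected, closed ones that the cluster does not
    extend further inside [B]. *)
Lemma inner_clusterE_depends B C :
  depends (touching B C) [set w | inner_cluster B w = [set` C]].
Proof.
move=> w w' h /= KC.
have C1 : 1%g \in C by have := inner_cluster1 B w; rewrite KC.
have step u v : u \in C -> open_adj (mask (inner B) w) u v -> v \in C.
  move=> uC uv; have : inner_cluster B w u by rewrite KC.
  move=> Ku; have : inner_cluster B w v by apply: rt_trans Ku _; exact: rt_step.
  by rewrite KC.
have adjE u v : u \in C ->
    open_adj (mask (inner B) w) u v <-> open_adj (mask (inner B) w') u v.
  move=> uC; split=> -[e /andP[we /asboolP eB] ee].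
    exists e => //; rewrite /mask; apply/andP; split; last exact/asboolP.
    by rewrite -h//; split=> //; case: (ends_cases ee) => -[? ?]; subst; [left|right].
  exists e => //; rewrite /mask; apply/andP; split; last exact/asboolP.
  by rewrite h//; split=> //; case: (ends_cases ee) => -[? ?]; subst; [left|right].
apply/seteqP; split=> v /=.
  move=> /clusterP[n].
  suff H u : u \in C -> reach (X := X) (mask (inner B) w') n u v -> v \in C by exact: H.
  elim: n u => [u uC /= <-//|n IH u uC [u' uu' r]].
  apply: (IH u') => //; case: uu' => [<-//|/adjE uu'].
  by apply: (step u) => //; exact: uu'.
move=> vC; have : inner_cluster B w v by rewrite KC.
move=> /clusterP[n r]; apply/clusterP; exists n.
suff H u : u \in C -> reach (X := X) (mask (inner B) w) n u v ->
    reach (X := X) (mask (inner B) w') n u v by exact: H.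
elim: n u {r} => [//|n IH u uC [u' uu' r]]; exists u'.
  by case: uu' => [->|uu']; [left|right; apply/adjE].
by apply: IH r; case: uu' => [<-//|]; exact: step.
Qed.

Lemma measurable_inner_clusterE B C :
  measurable [set w | inner_cluster B w = [set` C]].
Proof.
have [l hl] := inner_finite B.
apply: (@measurable_finite_depends _ l).
apply: (depends_sub _ (@inner_clusterE_depends B C)) => e [/hl].
by [].
Qed.

Lemma inner_cluster_finite_depends B z :
  exists l : seq (edge X), depends [set` l] [set w | inner_cluster B w z].
Proof.
have [l hl] := inner_finite B; exists l => w w' h.
rewrite /= /inner_cluster (_ : mask _ w' = mask (inner B) w)//.
apply/funext => e; rewrite /mask; case: asboolP; rewrite ?andbF// !andbT.
by move=> /hl el; rewrite h.
Qed.

Lemma measurable_inner_cluster B z : measurable [set w | inner_cluster B w z].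
Proof.
by have [l hl] := inner_cluster_finite_depends B z; exact: measurable_finite_depends hl.
Qed.

(* Decompose an open path at its last visit to the inner cluster. *)
Lemma reach_exit (N : {fset G}) B C w n u x :
  (forall w u v, open_adj (X := X) w u v -> exists2 t, t \in N & v = (u * t)%g) ->
  1%g \in B -> inner_cluster B w = [set` C] -> reach (X := X) w n u x ->
  [\/ x \in C,
      exists z t m, [/\ z \in C, t \in N, (z * t)%g \notin B, (m < n)%N &
                       reach (X := X) (mask (outer C) w) m (z * t)%g x] |
      u \notin C /\ reach (X := X) (mask (outer C) w) n u x].
Proof.
move=> hN B1 KC; have CB v : v \in C -> v \in B.
  by move=> vC; apply: (@inner_cluster_sub B w) => //; rewrite KC.
elim: n u => [u /= ->|n IH u [u' uu' /IH]].
  by case: (boolP (x \in C)) => ?; [apply: Or31|apply: Or33].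
case=> [xC|[z [t [m [zC tN ztB mn r]]]]|[u'C r]]; first exact: Or31.
  by apply: Or32; exists z, t, m; split=> //; exact: (leq_trans mn).
case: uu' => [<-|uu'] in u'C r *.
  by apply: Or33; split=> //; exact: reachS.
have [uC|uC] := boolP (u \in C); last first.
  apply: Or33; split=> //; exists u' => //; right.
  case: uu' => e we ee; exists e => //; rewrite /mask we/=; apply/asboolP.
  by case: (ends_cases ee) => -[? ?]; subst; split.
apply: Or32; have [t tN u'E] := hN _ _ _ uu'; exists u, t, n.
rewrite -u'E; split=> //; apply: contraNN u'C => u'B; clear u'E.
have Ku : inner_cluster B w u by rewrite KC.
suff : inner_cluster B w u' by rewrite KC.
apply: rt_trans Ku _; apply: rt_step; case: uu' => e we ee; exists e => //.
rewrite /mask we/=; apply/asboolP; have uB := CB _ uC.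
by case: (ends_cases ee) => -[? ?]; subst; split.
Qed.

(** A configuration has at most one [C] as its inner cluster, so the events in the sum are
    disjoint. *)
Lemma sum_inner_clusterE_le p B z :
  \sum_(C <- fpowerset B) (z \in C)%:R * prob p [set w | inner_cluster B w = [set` C]]
  <= prob p [set w | inner_cluster B w z].
Proof.
pose Z C : set (config (edge X)) := [set w | inner_cluster B w = [set` C]].
have := @prob_lin R _ p
  ((1, [set w | inner_cluster B w z]) ::
   [seq (- ((z \in C)%:R), Z C) | C <- fpowerset B]).
rewrite big_cons big_map /= mul1r.
under eq_bigr do rewrite mulNr.
rewrite sumrN subr_ge0; apply.
  move=> x; rewrite in_cons -map_comp => /orP[/eqP->|/mapP[C _ ->]].
    exact: measurable_inner_cluster.
  exact: measurable_inner_clusterE.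
move=> w; rewrite big_cons big_map /= mul1r.
under eq_bigr do rewrite mulNr.
rewrite sumrN subr_ge0.
have [[C [CB ZC]]|nC] := pselect (exists C, C \in fpowerset B /\ Z C w).
  rewrite (bigD1_seq C CB (fset_uniq _))/= big1 => [|C' C'C]; last first.
    rewrite [X in _ * X]indicE memNset ?mulr0// => ZC'; case/eqP: C'C.
    have /seteqP[h1 h2] : [set` C'] = [set` C] by rewrite -ZC -ZC'.
    by apply/fsetP => x; apply/idP/idP; [exact: h1|exact: h2].
  rewrite addr0 !indicE (mem_set ZC) mulr1.
  rewrite (_ : (w \in _) = (z \in C)) ?lexx//.
  apply/idP/idP; first by rewrite inE/= ZC.
  by move=> zC; rewrite inE/= ZC.
rewrite big_seq big1 => [|C CB]; first by rewrite indicE.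
by rewrite indicE memNset ?mulr0// => ZC; apply: nC; exists C.
Qed.

Section Bound.
Variables (p : R) (N B shell : {fset G}).
Hypothesis p01 : 0 <= p <= 1.
Hypothesis hN :
  forall w u v, open_adj (X := X) w u v -> exists2 t, t \in N & v = (u * t)%g.
Hypothesis B1 : 1%g \in B.
Hypothesis hshell : forall z t, z \in B -> t \in N -> (z * t)%g \notin B -> z \in shell.

(** A cruder form of the Duminil-Copin and Tassion quantity: it bounds the expected number of pairs
    [(z, t)] with [z] in the inner cluster and [z * t] outside [B], the probability that the exit
    edge is open being replaced by [1]. *)
Let phi := #|` N|%:R * \sum_(z <- shell) prob p [set w | inner_cluster B w z].
Let Z C : set (config (edge X)) := [set w | inner_cluster B w = [set` C]].

(** Union bound over the decompositions of [reach_exit]. The continuation uses only edges of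
    [outer C], so it is independent of the event that the inner cluster is [C]; its restriction to
    these edges is then dropped. *)
Let tau_exit n x : x \notin B -> tauN (X := X) p n.+1 1%g x <=
  \sum_(C <- fpowerset B) \sum_(z <- shell) \sum_(t <- N)
     (z \in C)%:R * prob p (Z C) * tauN (X := X) p n (z * t)%g x.
Proof.
move=> xB.
pose Ev (i : {fset G} * (G * G)) : set (config (edge X)) :=
  if i.2.1 \in i.1 then Z i.1 `&` [set w | reach (X := X) (mask (outer i.1) w) n
                                           (i.2.1 * i.2.2)%g x] else set0.
have mR C u : measurable [set w | reach (X := X) (mask (outer C) w) n u x].
  apply: (@measurable_preim_config _ _ _ (mask (outer C))
    [set w | reach (X := X) w n u x]); last exact: (measurable_reach lf).
  by move=> e; exact: measurable_mask.
pose l := [seq (C, i) | C <- fpowerset B, i <- [seq (z, t) | z <- shell, t <- N]].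
have mEv i : i \in l -> measurable (Ev i).
  move=> _; rewrite /Ev; case: ifP => // _; apply: measurableI; last exact: mR.
  exact: measurable_inner_clusterE.
apply: (@le_trans _ _ (\sum_(i <- l) prob p (Ev i))).
  apply: prob_bigcup_le => //; first exact: (measurable_reach lf).
  move=> w /= r.
  have [C CB KC] : exists2 C, C \in fpowerset B & inner_cluster B w = [set` C].
    exists [fset z in B | `[< inner_cluster B w z >]]%fset.
      by rewrite fpowersetE; apply/fsubsetP => z; rewrite !inE => /andP[].
    apply/seteqP; split=> z /=; rewrite !inE.
      by move=> Kz; apply/andP; split; [exact: inner_cluster_sub Kz|exact/asboolP].
    by move=> /andP[_ /asboolP].
  have CB' v : v \in C -> v \in B by move: CB; rewrite fpowersetE => /fsubsetP; apply.
  have C1 : 1%g \in C by have := inner_cluster1 B w; rewrite KC.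
  case: (@reach_exit N B C w n.+1 1%g x hN B1 KC r) => [/CB'|[z [t [m [zC tN ztB mn r']]]]|[]].
  - by rewrite (negbTE xB).
  - have zs := hshell (CB' _ zC) tN ztB.
    exists (C, (z, t)).
      apply/allpairsP; exists (C, (z, t)); split=> //.
      by apply/allpairsP; exists (z, t).
    by rewrite /Ev /= zC; split=> //=; exact: (reach_leq _ r').
  - by rewrite C1.
rewrite /l big_allpairs; apply: ler_sum => C _; rewrite big_allpairs.
apply: ler_sum => z _; apply: ler_sum => t _.
rewrite /Ev /=; case: ifP => zC; last by rewrite prob_set0 !mul0r.
rewrite mul1r (prob_indep cE p01 (D := touching B C) (D' := outer C)).
- apply: ler_wpM2l; first exact: prob_ge0.
  apply: prob_le => //; first exact: (measurable_reach lf).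
  by move=> w; apply: increasing_reach => e /andP[].
- exact: measurable_inner_clusterE.
- exact: mR.
- exact: inner_clusterE_depends.
- have dT : depends setT [set w | reach (X := X) w n (z * t)%g x].
    by move=> w w' h; rewrite (_ : w = w')//; apply/funext => e; exact: h.
  by apply: (depends_sub _ (mask_depends (D := outer C) dT)) => e [].
- by apply/seteqP; split=> // e [[_ [eC|eC]] [/negP h1 /negP h2]].
Qed.

Let sum_tau_step n M (F : {fset G}) :
  (forall F, \sum_(x <- F) tauN (X := X) p n 1%g x <= M) ->
  \sum_(x <- F) tauN (X := X) p n.+1 1%g x <= #|` B|%:R + phi * M.
Proof.
move=> hM.
have M0 : 0 <= M by have := hM fset0; rewrite big_seq_fset0.
rewrite (big_fsetID _ (fun x => x \in B))/=; apply: lerD.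
  apply: (@le_trans _ _ (\sum_(x <- B) (1 : R))); last first.
    by rewrite big_const_seq count_predT iter_addr_0.
  apply: (@le_trans _ _ (\sum_(x <- [fset x in F | x \in B]%fset) (1 : R))).
    by apply: ler_sum => x _; apply: prob_le1; exact: (measurable_reach lf).
  by apply: ler_sum_sub => [|x|x]; [exact: fset_uniq|rewrite !inE => /andP[]|].
set F' := [fset _ | _ in _ & _]%fset.
apply: (@le_trans _ _ (\sum_(x <- F') \sum_(C <- fpowerset B) \sum_(z <- shell)
  \sum_(t <- N) (z \in C)%:R * prob p (Z C) * tauN (X := X) p n (z * t)%g x)).
  rewrite [leLHS]big_seq [leRHS]big_seq; apply: ler_sum => x.
  by rewrite !inE => /andP[_ /= xB]; exact: tau_exit.
rewrite exchange_big/=.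
under eq_bigr do rewrite exchange_big/=.
rewrite exchange_big/= /phi mulrAC mulr_sumr; apply: ler_sum => z _.
apply: (@le_trans _ _ (\sum_(C <- fpowerset B)
   ((z \in C)%:R * prob p (Z C)) * (#|` N|%:R * M))).
  apply: ler_sum => C _; rewrite exchange_big/=.
  under eq_bigr do rewrite -mulr_sumr.
  rewrite -mulr_sumr; apply: ler_wpM2l.
    by rewrite mulr_ge0// ?ler0n// prob_ge0.
  apply: (@le_trans _ _ (\sum_(t <- N) M)); last first.
    by rewrite big_const_seq count_predT iter_addr_0 mulr_natl.
  apply: ler_sum => t _.
  (* Translating by [(z * t)^-1] brings the starting point back to the identity, so the bound [M]
     applies. *)
  pose F'' := [fset ((z * t)^-1 * x)%g | x in F']%fset.
  apply: le_trans (hM F''); rewrite /F'' [leRHS]big_imfset/=; last first.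
    by move=> x y _ _; exact: mulgI.
  apply: ler_sum => x _.
  by rewrite -(tauN_translate finS cG (z * t)%g n 1%g _ p01) mulg1 mulVKg.
rewrite -mulr_suml mulrC; apply: ler_wpM2l; first by rewrite mulr_ge0// ler0n.
exact: sum_inner_clusterE_le.
Qed.

Lemma mean_finite : phi < 1 -> (mean_cluster_size (X := X) 1%g p < +oo)%E.
Proof.
move=> phi1; have phi0 : 0 <= phi.
  by rewrite mulr_ge0// ?ler0n// sumr_ge0// => z _; exact: prob_ge0.
(* The fixed point of the recursion in [sum_tau_step]; it bounds all sums uniformly in [n]. *)
pose M := #|` B|%:R / (1 - phi).
have B0 : 1 <= (#|` B|%:R : R).
  by rewrite ler1n cardfs_gt0; apply/fset0Pn; exists 1%g.
have M1 : 1 <= M by rewrite /M ler_pdivlMr ?subr_gt0// mul1r; lra.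
have ME : #|` B|%:R + phi * M = M by rewrite /M; field; rewrite subr_eq0 gt_eqF.
have key n (F : {fset G}) : \sum_(x <- F) tauN (X := X) p n 1%g x <= M.
  elim: n F => [|n IH] F; last by rewrite -ME; exact: sum_tau_step.
  apply: le_trans M1.
  have t0 x : x != 1%g -> tauN (X := X) p 0 1%g x = 0.
    move=> x1; rewrite /tauN (_ : [set _ | _] = set0) ?prob_set0//.
    by apply/seteqP; split=> // w /= e; case/eqP: x1.
  have [F1|F1] := boolP (1%g \in F).
    rewrite (bigD1_seq (1%g : G) F1 (fset_uniq _))/= big1 ?addr0//.
    by apply: prob_le1; exact: (measurable_reach lf).
  rewrite big_seq big1// => x xF; apply: t0.
  by apply: contraNneq F1 => <-.
apply: (@le_lt_trans _ _ M%:E); last exact: ltry.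
apply: (mean_le lf cG) => F; apply: (sum_tau_le lf) => n; exact: key.
Qed.

End Bound.

(** The quantity [phi] involves finitely many edges, so it is a polynomial in the parameter and
    [phi < 1] is stable under small changes. It remains to find [B] with [phi < 1] at [p]. *)
Lemma mean_finite_open p : 0 <= p <= 1 ->
  (mean_cluster_size (X := X) 1%g p < +oo)%E ->
  exists2 eps, 0 < eps & forall q, 0 <= q <= 1 -> `|q - p| < eps ->
    (mean_cluster_size (X := X) 1%g q < +oo)%E.
Proof.
move=> p01; case E : (mean_cluster_size _ p) => [r| |] // _; last first.
  have := sum_tau_le_mean lf cG 1%g p fset0.
  by rewrite E.
have [N hN] := cayley_neighbours finS.
pose d : R := #|` N|%:R; pose e0 := (d + 1)^-1.
have d0 : 0 <= d by rewrite ler0n.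
have e00 : 0 < e0 by rewrite invr_gt0 ltr_wpDl.
have sum_le (F : {fset G}) : \sum_(x <- F) tau (X := X) p 1%g x <= r.
  by have := sum_tau_le_mean lf cG 1%g p F; rewrite E lee_fin.
(* [F0] carries all but [e0] of the mean, so the vertices of [B] outside [F0] carry at most [e0],
   and [d * e0 < 1]. *)
have [F0 hF0] : exists F0 : {fset G}, r - e0 < \sum_(x <- F0) tau (X := X) p 1%g x.
  apply: contrapT => /forallNP h.
  have : (mean_cluster_size (X := X) 1%g p <= (r - e0)%:E)%E.
    by apply: (mean_le lf cG) => F; rewrite leNgt; apply/negP/h.
  by rewrite E lee_fin lerBrDr gerDl leNgt e00.
(* All neighbours of [F0] are in [B], so [B] can be left only from [shell]. *)
pose B := (1%g |` F0 `|` [fset (z * t)%g | z in F0, t in N])%fset.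
pose shell := (B `\` F0)%fset.
have B1 : 1%g \in B by rewrite !inE eqxx.
have hshell z t : z \in B -> t \in N -> (z * t)%g \notin B -> z \in shell.
  move=> zB tN; rewrite /shell in_fsetD zB andbT; apply: contraNN => zF0.
  by rewrite in_fsetU; apply/orP; right; apply/imfset2P; exists z => //; exists t.
pose phi q := d * \sum_(z <- shell) prob q [set w | inner_cluster B w z].
have phip : phi p < 1.
  have : \sum_(z <- shell) prob p [set w | inner_cluster B w z] <= e0.
    apply: (@le_trans _ _ (\sum_(z <- shell) tau (X := X) p 1%g z)).
      apply: ler_sum => z _; apply: prob_le.
      - exact: measurable_inner_cluster.
      - exact: (measurable_connected lf).
      - move=> w /= /clusterP[n rn]; apply/clusterP; exists n.
        by move: rn; apply: increasing_reach => e /andP[].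
    have := sum_le (F0 `|` shell)%fset.
    rewrite (_ : \sum_(x <- (F0 `|` shell)%fset) _ =
      \sum_(x <- F0) tau (X := X) p 1%g x + \sum_(x <- shell) tau (X := X) p 1%g x).
      lra.
    rewrite -big_cat/=; apply: perm_big; apply: uniq_perm; rewrite ?fset_uniq//.
      rewrite cat_uniq !fset_uniq/= andbT; apply/hasPn => x.
      by rewrite in_fsetD => /andP[].
    by move=> x; rewrite mem_cat in_fsetU.
  move=> h; apply: (@le_lt_trans _ _ (d * e0)); first exact: ler_wpM2l.
  by rewrite /e0 ltr_pdivrMr ?mul1r ?ltrDl ?ltr_wpDl.
have [Q hQ] : exists Q : {poly R}, forall q, 0 <= q <= 1 -> phi q = Q.[q].
  have /choice[Qz hQz] : forall z, exists Q : {poly R}, forall q, 0 <= q <= 1 ->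
      prob q [set w | inner_cluster B w z] = Q.[q].
    move=> z; have [l hl] := inner_cluster_finite_depends B z.
    exact: (finite_depends_poly R cE hl).
  exists (d *: \sum_(z <- shell) Qz z) => q q01.
  by rewrite hornerZ horner_sum /phi; congr (_ * _); apply: eq_bigr => z _; exact: hQz.
rewrite hQ// in phip; have [eps eps0 heps] := poly_lt_near phip.
exists eps => // q q01 qp.
apply: (mean_finite q01 hN B1 hshell); rewrite -/d -/(phi q) hQ//.
exact: heps.
Qed.

End FiniteCriterion.

(** * Geometry of free products *)

Section FreeProductGeometry.
Variables (I : finType) (G : I -> groupType) (S : forall i, set (G i)).
Arguments S : clear implicits.
Local Notation V := (free_product G).
Local Notation X := (cayley (fp_gens S)).
Implicit Types (w : config (edge X)) (u v : V) (b c : letter G).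

Definition hd v : option (letter G) := ohead v.

(** The condition under which a non-identity letter of type [i] can be put in front of [v] without
    reduction. *)
Definition hd_off i v : bool := if hd v is Some c then tag c != i else true.

Definition fp_letter b : V := fp_in (tag b) (tagged b).

Lemma word_fp_in i (x : G i) :
  word (fp_in i x) = if x == 1%g then [::] else [:: Tagged G x].
Proof. by []. Qed.

Lemma word_inj u v : word u = word v -> u = v.
Proof. exact: val_inj. Qed.

Lemma hd_fp_in i (x : G i) :
  hd (fp_in i x) = if x == 1%g then None else Some (Tagged G x).
Proof. by rewrite /hd word_fp_in; case: eqP. Qed.

Lemma hd_fp_in_inj i (x y : G i) : hd (fp_in i x) = hd (fp_in i y) -> x = y.
Proof.
rewrite !hd_fp_in; case: eqP => [->|_]; case: eqP => // _ /Some_inj h.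
by move: (congr1 (tagged_as (Tagged G x)) h); rewrite !tagged_as_existT.
Qed.

Lemma fp_in1 i : fp_in i (1%g : G i) = 1%g.
Proof. by apply: word_inj; rewrite word_fp_in eqxx. Qed.

Lemma mulw_cons b (s t : seq (letter G)) : mulw (b :: s) t = consw b (mulw s t).
Proof. by []. Qed.

(** The tail times [c] is empty or still begins with the type of [b'], so nothing can merge with
    [b]. *)
Lemma mulw_head b b' (s : seq (letter G)) c : reduced [:: b, b' & s] ->
  ohead (mulw [:: b, b' & s] [:: c]) = Some b.
Proof.
move=> r.
suff tagE a s' : reduced (a :: s') ->
    if mulw (a :: s') [:: c] is d :: _ then tag d == tag a else true.
  have b1 := reduced_head r; have bb' : tag b != tag b' by case/and3P: r.
  have := tagE b' s (reduced_behead r).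
  rewrite (mulw_cons b (b' :: s)).
  case: (mulw (b' :: s) _) => [|d t]; first by rewrite /consw (negbTE b1).
  move=> /eqP dE; rewrite /consw (negbTE b1).
  by rewrite dE (negbTE bb').
elim: s' a => [|a' s' IH] a ra.
  rewrite /= /consw (negbTE (reduced_head ra)).
  by case: ifP => [_|//]; case: ifP.
have a1 := reduced_head ra; have aa' : tag a != tag a' by case/and3P: ra.
have := IH a' (reduced_behead ra); rewrite (mulw_cons a (a' :: s')).
case: (mulw (a' :: s') _) => [|d t]; rewrite /consw (negbTE a1) ?eqxx//.
by move=> /eqP dE; rewrite dE (negbTE aa') eqxx.
Qed.

(* This is where the cosets of the factors are glued together like a tree. *)
Lemma mul_fp_in_cases v j (y : G j) : y != 1%g ->
  (exists b, hd v = Some b /\ hd (v * fp_in j y)%g = Some b) \/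
  (exists x : G j, v = fp_in j x).
Proof.
move=> y1.
have E : word (v * fp_in j y)%g = mulw v [:: Tagged G y].
  by rewrite -[LHS]/(mulw _ _) word_fp_in (negbTE y1).
case W : (word v) => [|b [|b' s]].
- by right; exists 1%g; apply: word_inj; rewrite W fp_in1.
- have b1 : tagged b != 1%g.
    by have := word_reduced v; rewrite W => /reduced_head.
  have [bj|bj] := eqVneq (tag b) j.
    right; case: b bj b1 W => k x /= kj x1 W; case: _ / kj in y y1 E *.
    by exists x; apply: word_inj; rewrite W word_fp_in (negbTE x1).
  left; exists b; rewrite /hd E W /=; split=> //.
  by rewrite /consw (negbTE b1) /= (negbTE bj).
- left; exists b; rewrite /hd E W; split=> //; apply: mulw_head.
  by rewrite -W; exact: word_reduced.
Qed.

Lemma word_fp_letter_mul b v : tagged b != 1%g ->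
  hd_off (tag b) v ->
  word (fp_letter b * v)%g = b :: word v.
Proof.
move=> b1 hv; have -> : word (fp_letter b * v)%g = consw b v.
  rewrite -[LHS]/(mulw _ _) /fp_letter word_fp_in (negbTE b1).
  by case: b b1 hv.
apply: consw_id; apply: reduced_cons => //; last exact: word_reduced.
by move: hv; rewrite /hd_off /hd; case: (word v) => //= c s; rewrite eq_sym.
Qed.

Lemma word_fp_letterV_mul b v : hd v = Some b ->
  word v = b :: word ((fp_letter b)^-1 * v)%g /\
  hd_off (tag b) ((fp_letter b)^-1 * v)%g.
Proof.
rewrite /hd; case W : (word v) => [//|d s] [db]; rewrite db in W *.
have rv := word_reduced v; rewrite W in rv.
have -> : ((fp_letter b)^-1 * v)%g = FreeProduct (reduced_behead rv).
  apply: (mulgI (fp_letter b)); rewrite mulVKg; apply: word_inj.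
  rewrite word_fp_letter_mul ?W//; first exact: (reduced_head rv).
  by rewrite /hd_off /hd /=; case: s rv {W} => //= c s /andP[_ /= /andP[bc _]]; rewrite eq_sym.
split=> //; rewrite /hd_off /hd /=; case: s rv {W} => //= c s /andP[_ /= /andP[bc _]]; rewrite eq_sym.
by [].
Qed.

(** The retraction onto the copy of [G i] through the identity: a word hangs from that copy at its
    first letter if this has type [i], and otherwise at [1], the default value of [tagged_as]. *)
Definition proj i v : G i :=
  if hd v is Some b then tagged_as (Tagged G (1%g : G i)) b else 1%g.

Lemma proj_fp_in i (x : G i) : proj i (fp_in i x) = x.
Proof.
by rewrite /proj hd_fp_in; case: eqP => [->//|_]; exact: tagged_as_existT.
Qed.

Lemma proj_fp_in_neq i j (x : G j) : i != j -> proj i (fp_in j x) = 1%g.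
Proof.
move=> ij; rewrite /proj hd_fp_in; case: eqP => // _.
by rewrite /tagged_as/=; case: eqP => // e; rewrite e eqxx in ij.
Qed.

Definition gen i (s : S i) : fp_gens S.
Proof.
exists (fp_in i (val s)); apply/mem_set; exists i => //.
by exists (val s) => //; exact: (set_mem (valP s)).
Defined.

Definition embed i (e : edge (cayley (S i))) : edge X := (fp_in i e.1, gen e.2).

Lemma embed_inj i : injective (@embed i).
Proof.
move=> [x s] [y t] e.
have /hd_fp_in_inj -> : hd (fp_in i x) = hd (fp_in i y).
  exact: (congr1 (fun e : edge X => hd e.1) e).
have /hd_fp_in_inj/val_inj -> // : hd (fp_in i (val s)) = hd (fp_in i (val t)).
exact: (congr1 (fun e : edge X => hd (val e.2)) e).
Qed.

Lemma gensP (s : fp_gens S) : exists i (t : S i), s = gen t.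
Proof.
have [i _ [x Sx xs]] := set_mem (valP s).
by exists i, (exist _ x (mem_set Sx)); apply/val_inj; rewrite /= xs.
Qed.

(** By [mul_fp_in_cases], right multiplication by an element of a factor changes the first letter
    only inside the copy of that factor through the identity. *)
Lemma crossing_edge (e : edge X) : hd e.1 <> hd (e.1 * val e.2)%g ->
  exists i (e' : edge (cayley (S i))), e = embed e'.
Proof.
case: e => v s /=; have [i [t ->]] := gensP s => /= ne.
have [t1|t1] := eqVneq (val t) 1%g; first by rewrite t1 fp_in1 mulg1 in ne.
case: (mul_fp_in_cases v t1) => [[b [h1 h2]]|[x vx]]; first by rewrite h1 h2 in ne.
by exists i, (x, t); rewrite /embed/= vx.
Qed.

Lemma ends_embed i (e : edge (cayley (S i))) :
  ends (embed e) = (fp_in i e.1, fp_in i (e.1 * val e.2)%g).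
Proof. by rewrite /= fp_inM. Qed.

Lemma reach_proj i w n u v : reach (X := X) w n u v ->
  reach (X := cayley (S i)) (w \o @embed i) n (proj i u) (proj i v).
Proof.
apply: (@reach_sim X (cayley (S i)) w _ (proj i)) => {}u {}v [e we ee].
suff : proj i (ends e).1 = proj i (ends e).2 \/
    open_adj (X := cayley (S i)) (w \o @embed i) (proj i (ends e).1) (proj i (ends e).2).
  case: ee => -> /= [->|]; [by left|by right|by left|].
  by move/open_adj_sym; right.
have [h|/crossing_edge[j [e' ee']]] := pselect (hd e.1 = hd (e.1 * val e.2)%g).
  by left; rewrite /= /proj h.
rewrite ee' ends_embed /=; have [ij|ij] := eqVneq i j; last first.
  by left; rewrite !proj_fp_in_neq.
case: j / ij e' ee' => e' ee'; right; rewrite !proj_fp_in.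
by exists e'; [rewrite /= -ee'|left].
Qed.

(** The retraction onto the branch of words beginning with [b], which a path can enter only at its
    root [fp_letter b]. *)
Definition retract b v : V := if hd v == Some b then v else fp_letter b.

Definition branch b : set (edge X) :=
  [set e | hd e.1 = Some b /\ hd (e.1 * val e.2)%g = Some b].

Lemma reach_retract b w n u v : reach (X := X) w n u v ->
  reach (X := X) (mask (branch b) w) n (retract b u) (retract b v).
Proof.
apply: (@reach_sim X X w _ (retract b)) => {}u {}v [e we ee].
suff : retract b (ends e).1 = retract b (ends e).2 \/
    open_adj (X := X) (mask (branch b) w) (retract b (ends e).1) (retract b (ends e).2).
  case: ee => -> /= [->|]; [by left|by right|by left|].
  by move/open_adj_sym; right.
have retr i (x : G i) : retract b (fp_in i x) = fp_letter b.
  rewrite /retract; case: eqP => //; rewrite hd_fp_in; case: eqP => // _ [<-].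
  by [].
have [h|/crossing_edge[j [e' ->]]] := pselect (hd e.1 = hd (e.1 * val e.2)%g).
  have [hb|hb] := eqVneq (hd e.1) (Some b); last first.
    by left; rewrite /retract /= -h (negbTE hb).
  right; exists e; first by rewrite /mask we/=; apply/asboolP; split=> //; rewrite -h.
  by left; rewrite /retract /= -h hb eqxx.
by left; rewrite ends_embed /= !retr.
Qed.

Definition crossing : set (edge X) := [set e | hd e.1 <> hd (e.1 * val e.2)%g].

Lemma crossing_depends i n (x y : G i) : depends crossing
  [set w : config (edge X) | reach (X := cayley (S i)) (w \o @embed i) n x y].
Proof.
move=> w w' h.
apply: (@reach_sim (cayley (S i)) (cayley (S i)) _ _ id) => u v [e we ee].
(* A generator equal to [1] gives a loop, whose image is not in [crossing]; the path stays in place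
   instead of using it. *)
have [s1|s1] := eqVneq (val e.2) 1%g.
  by left; case: ee => -[<- <-]; rewrite s1 mulg1.
right; exists e => //=; rewrite -h// /crossing /= -fp_inM => /hd_fp_in_inj.
by move/esym/eqP; rewrite -[X in _ == X]mulg1 (inj_eq (mulgI _)) (negbTE s1).
Qed.

Lemma branch_crossing b : crossing `&` branch b = set0.
Proof. by apply/seteqP; split=> // e [h [h1 h2]]; apply: h; rewrite h1 h2. Qed.

Lemma branch_disjoint b c : b != c -> branch b `&` branch c = set0.
Proof.
move=> bc; apply/seteqP; split=> // e [[h1 _] [h2 _]].
by move: h2; rewrite h1 => -[] /eqP; rewrite (negbTE bc).
Qed.

Lemma finite_fp_gens : (forall i, finite_set (S i)) -> finite_set (fp_gens S).
Proof.
by move=> finS; apply: bigcup_finite => [|i _]; [exact: finite_finset|exact: finite_image].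
Qed.

Lemma countable_free_product :
  (forall i, countable [set: G i]) -> countable [set: free_product G].
Proof.
move=> cG; have h i : exists f : G i -> nat, injective f.
  have /countable_injP[f f_inj] := cG i.
  by exists f => x y; apply: f_inj; rewrite inE.
pose f i := sval (cid (h i)); have hf i : injective (f i) by rewrite /f; case: cid.
pose g (b : letter G) : nat := choice.pickle (enum_rank (tag b) : nat, f (tag b) (tagged b)).
have g_inj : injective g.
  move=> [i x] [j y] /(pcan_inj choice.pickleK) [/= /ord_inj /enum_rank_inj ij].
  by case: j / ij y => y /hf ->.
apply: (@countable_inj _ (fun v : V => choice.pickle (map g (word v)))).
move=> u v /(pcan_inj choice.pickleK) /(inj_map g_inj) uv; exact: word_inj.
Qed.

End FreeProductGeometry.

(** * The subcritical regime *)

Lemma le_of_eq d (T : porderType d) (x y : T) : x = y -> (x <= y)%O.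
Proof. by move=> ->. Qed.

Section FreeProductPercolation.
Variables (R : realType) (I : finType) (G : I -> groupType) (S : forall i, set (G i)).
Arguments S : clear implicits.
Hypothesis finS : forall i, finite_set (S i).
Hypothesis cG : forall i, countable [set: G i].
Local Notation V := (free_product G).
Local Notation X := (cayley (fp_gens S)).
Local Notation Y i := (cayley (S i)).
Local Notation lf := (cayley_locally_finite (finite_fp_gens finS)).
Local Notation lfY i := (cayley_locally_finite (finS i)).
Local Notation cV := (countable_free_product cG).
Local Notation cE := (@cayley_countable_edge _ (fp_gens S) cV).
Local Notation cEY i := (@cayley_countable_edge _ (S i) (cG i)).
Implicit Types (w : config (edge X)) (u v : V) (b c : letter G) (p q : R).

Definition factor_reach n b : set (config (edge X)) :=
  [set w : config (edge X) | reach (X := Y (tag b)) (w \o @embed _ _ S (tag b)) n 1%g (tagged b)].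

Definition tau_letter p n b : R := tauN (X := Y (tag b)) p n 1%g (tagged b).

Lemma factor_reach_depends n b : depends (@crossing _ _ S) (factor_reach n b).
Proof. exact: crossing_depends. Qed.

Lemma measurable_factor_reach n b : measurable (factor_reach n b).
Proof.
apply: (@measurable_preim_config _ _ _ (fun w : config (edge X) => w \o @embed _ _ S (tag b))
  [set w | reach (X := Y (tag b)) w n 1%g (tagged b)]).
  by move=> e; exact: measurable_edge.
exact: (measurable_reach (lfY (tag b))).
Qed.

Lemma prob_factor_reach p n b : 0 <= p <= 1 ->
  prob p (factor_reach n b) = tau_letter p n b.
Proof.
move=> p01; apply: (prob_push cE (cEY (tag b)) p01 (@embed_inj _ _ S (tag b))
  (A := [set w | reach (X := Y (tag b)) w n 1%g (tagged b)])).
exact: (measurable_reach (lfY (tag b))).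
Qed.

Lemma measurable_masked_reach D n u v :
  measurable [set w | reach (X := X) (mask D w) n u v].
Proof.
apply: (@measurable_preim_config _ _ _ (mask D)
  [set w | reach (X := X) w n u v]); last exact: (measurable_reach lf).
by move=> e; exact: measurable_mask.
Qed.

Lemma masked_reach_depends D n u v :
  depends D [set w | reach (X := X) (mask D w) n u v].
Proof.
have dT : depends setT [set w | reach (X := X) w n u v].
  by move=> w w' h; rewrite (_ : w = w')//; apply/funext => e; exact: h.
by apply: (depends_sub _ (mask_depends (D := D) dT)) => e [].
Qed.

(** A path to [v] projects to a path from [1] to [b] in the factor, an event decided by crossing
    edges, and retracts to a path from [b] to [v] inside the branch of [b]. The two edge sets are
    disjoint, so the events are independent. *)
Lemma tauN_free_product p n b v : 0 <= p <= 1 -> hd v = Some b ->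
  tauN (X := X) p n 1%g v <=
  tau_letter p n b * tauN (X := X) p n 1%g ((fp_letter b)^-1 * v)%g.
Proof.
move=> p01 hv.
rewrite -[X in _ * X](tauN_translate (finite_fp_gens finS) cV (fp_letter b) _ _ _ p01).
rewrite mulg1 mulVKg.
pose M := [set w | reach (X := X) (mask (@branch _ _ S b) w) n (fp_letter b) v].
apply: (@le_trans _ _ (prob p (factor_reach n b `&` M))).
  apply: prob_le.
  - exact: (measurable_reach lf).
  - by apply: measurableI; [exact: measurable_factor_reach|exact: measurable_masked_reach].
  move=> w r; split; rewrite /factor_reach /=.
    have := reach_proj (tag b) r; rewrite {2}/proj hv /proj /= .
    by case: b hv {M} => i x hv; rewrite /= tagged_as_existT.
  by have := reach_retract b r; rewrite /retract /= hv eqxx.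
rewrite (prob_indep cE p01 _ _ (@factor_reach_depends n b)
  (@masked_reach_depends (@branch _ _ S b) n (fp_letter b) v)).
- rewrite prob_factor_reach//; apply: ler_wpM2l; first exact: prob_ge0.
  apply: prob_le; [exact: measurable_masked_reach|exact: (measurable_reach lf)|].
  by move=> w; apply: increasing_reach => e /andP[].
- exact: measurable_factor_reach.
- exact: measurable_masked_reach.
- exact: branch_crossing.
Qed.

Definition chi i p : \bar R := mean_cluster_size (X := Y i) 1%g p.

Lemma sum_tau_factor i p n (L : seq (G i)) : uniq L -> 1%g \notin L ->
  ((1 + \sum_(x <- L) tauN (X := Y i) p n 1%g x)%:E <= chi i p)%E.
Proof.
move=> uL L1; pose F := [fset x in 1%g :: L]%fset.
apply: (@le_trans _ _ (\sum_(x <- F) tau (X := Y i) p 1%g x)%:E); last first.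
  exact: (sum_tau_le_mean (lfY i) (cG i)).
rewrite lee_fin; have -> : (1 : R) = tau (X := Y i) p 1%g 1%g.
  apply/eqP; rewrite eq_le; apply/andP; split.
    rewrite -(@prob_setT R (edge (Y i)) p); apply: prob_le => //.
      exact: (measurable_connected (lfY i)).
    by move=> w _; exact: rt_refl.
  by apply: prob_le1; exact: (measurable_connected (lfY i)).
apply: (@le_trans _ _ (\sum_(x <- 1%g :: L) tau (X := Y i) p 1%g x)).
  rewrite big_cons lerD2l; apply: ler_sum => x _; exact: (tauN_le (lfY i)).
apply: ler_sum_sub => [|x xL|x]; [by rewrite /= L1|by move: xL; rewrite !inE|exact: tau_ge0].
Qed.

Lemma chi_ge1 i p : (1 <= chi i p)%E.
Proof. by have := @sum_tau_factor i p 0 [::] isT isT; rewrite big_nil addr0. Qed.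

Section Subcritical.
Variable p : R.
Hypothesis p01 : 0 <= p <= 1.
Hypothesis fin_chi : forall i, chi i p \is a fin_num.
Let x i : R := fine (chi i p).
(** With [f] the full sum, [1 + U * f = U], and leaving out the term of type [i] turns this value
    into [U / x i]. *)
Let U : R := (1 - \sum_i (1 - (x i)^-1))^-1.
Hypothesis sub : \sum_i (1 - (x i)^-1) < 1.

Let x1 i : 1 <= x i.
Proof. by rewrite -lee_fin /x fineK// chi_ge1. Qed.

Let x0 i : 0 < x i. Proof. exact: lt_le_trans (x1 i). Qed.

Let U0 : 0 < U. Proof. by rewrite invr_gt0 subr_gt0. Qed.

Let sum_letters n (H : seq (letter G)) j : uniq H ->
  (forall b, b \in H -> tagged b != 1%g) ->
  \sum_(b <- H | tag b == j) tau_letter p n b <= x j - 1.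
Proof.
move=> uH H1; pose L := [seq tagged_as (Tagged G (1%g : G j)) b | b <- H & tag b == j].
have tE b : tag b == j -> b = Tagged G (tagged_as (Tagged G (1%g : G j)) b).
  by case: b => i y /= /eqP e; case: _ / e; rewrite tagged_as_existT.
have uL : uniq L.
  rewrite map_inj_in_uniq ?filter_uniq// => b c.
  by rewrite !mem_filter => /andP[/tE bE _] /andP[/tE cE _] h; rewrite bE cE h.
have L1 : 1%g \notin L.
  apply/negP => /mapP[b]; rewrite mem_filter => /andP[/tE bE /H1] + e.
  by rewrite bE -e eqxx.
have := @sum_tau_factor j p n L uL L1.
rewrite -[chi j p]fineK// lee_fin -/(x j) -lerBrDl => h; apply: le_trans h.
rewrite /L big_map big_filter; apply: le_of_eq; apply: eq_bigr => b /tE bE.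
by rewrite {1}bE.
Qed.

(** Induction on word length, grouping words by their first letter [b]. The remaining word begins
    with a type other than [tag b], hence the statement for a general predicate [P] on types. *)
Let sum_words k n (P : pred I) (F : {fset V}) :
  (forall v, v \in F -> (size (word v) <= k)%N) ->
  (forall v b, v \in F -> hd v = Some b -> P (tag b)) ->
  \sum_(v <- F) tauN (X := X) p n 1%g v <= 1 + U * \sum_(j | P j) (1 - (x j)^-1).
Proof.
elim: k P F => [|k IH] P F Fk FP.
  have F1 v : v \in F -> v = 1%g.
    move=> /Fk; rewrite leqn0 size_eq0 => /eqP v0; apply: word_inj.
    by rewrite v0.
  apply: (@le_trans _ _ 1).
    apply: (@le_trans _ _ (\sum_(v <- [:: 1%g : V]) tauN (X := X) p n 1%g v)).
      apply: ler_sum_sub => [|v vF|v]; [exact: fset_uniq| |exact: prob_ge0].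
      by rewrite inE (F1 v vF).
    by rewrite big_seq1; apply: prob_le1; exact: (measurable_reach lf).
  rewrite lerDl mulr_ge0 ?(ltW U0)// sumr_ge0// => j _.
  by rewrite subr_ge0 invf_le1.
pose O := [fset hd v | v in F]%fset.
pose H := pmap id (enum_fset O).
have Hhd b : b \in H -> exists2 v, v \in F & hd v = Some b.
  rewrite mem_pmap => /mapP[a aO ob].
  by move: aO => /imfsetP[v /= vF ov]; exists v => //; rewrite -ov -ob.
have H1 b : b \in H -> tagged b != 1%g.
  move=> /Hhd[v _]; rewrite /hd; case W : (word v) => [//|d s] [<-].
  by have := word_reduced v; rewrite W; exact: reduced_head.
have uH : uniq H by apply: (@pmap_uniq _ _ id Some); [case|exact: fset_uniq].
(* [U / x (tag b)] is the induction bound for words not beginning with type [tag b]; summed over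
   letters of type [j] the weights give at most [U * (1 - 1 / x j)]. *)
pose h (a : option (letter G)) : R :=
  if a is Some b then tau_letter p n b * (U / x (tag b)) else 1.
have h0 a : 0 <= h a.
  case: a => //= b; rewrite mulr_ge0 ?prob_ge0// divr_ge0//; exact: ltW.
rewrite (partition_big_imfset _ (@hd I G))/=.
apply: (@le_trans _ _ (\sum_(a <- O) h a)).
  rewrite [leLHS]big_seq [leRHS]big_seq; apply: ler_sum; case=> [b|] bO /=; last first.
    apply: (@le_trans _ _ (\sum_(v <- [:: 1%g : V]) tauN (X := X) p n 1%g v)).
      rewrite -big_filter; apply: ler_sum_sub => [|v|v]; last exact: prob_ge0.
        by rewrite filter_uniq// fset_uniq.
      rewrite mem_filter inE /hd => /andP[hv _]; apply/eqP; apply: word_inj.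
      by case: (word v) hv.
    by rewrite big_seq1; apply: prob_le1; exact: (measurable_reach lf).
  pose F' := [fset ((fp_letter b)^-1 * v)%g | v in F & hd v == Some b]%fset.
  have F'P v : v \in F' -> exists u, [/\ u \in F, hd u = Some b & v = ((fp_letter b)^-1 * u)%g].
    by move=> /imfsetP[u /=]; rewrite inE => /andP[uF /eqP hu] ->; exists u.
  apply: (@le_trans _ _ (tau_letter p n b *
      \sum_(v <- F') tauN (X := X) p n 1%g v)).
    rewrite /F' big_imfset/=; last by move=> u v _ _; exact: mulgI.
    rewrite mulr_sumr big_filter [leLHS]big_mkcond [leRHS]big_mkcond/=.
    apply: ler_sum => v _.
    by case: eqP => // hv; exact: tauN_free_product.
  apply: ler_wpM2l; first exact: prob_ge0.
  have := IH (fun j => j != tag b) F' _ _ => /(_ _)/wrap[|/(_ _)/wrap[|]].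
  - move=> v /F'P[u [uF hu ->]]; have [W _] := word_fp_letterV_mul hu.
    by have := Fk u uF; rewrite W.
  - move=> v c /F'P[u [uF hu ->]]; have [_ W] := word_fp_letterV_mul hu.
    by move: W => + hc; rewrite /hd_off hc.
  move=> /le_trans; apply; apply: le_of_eq.
  have sE : \sum_j (1 - (x j)^-1) = 1 - U^-1 by rewrite /U invrK; ring.
  move: sE; rewrite (bigD1 (tag b))//= => sE.
  have -> : \sum_(j | j != tag b) (1 - (x j)^-1) = 1 - U^-1 - (1 - (x (tag b))^-1).
    by rewrite -sE; ring.
  by field; rewrite !gt_eqF.
apply: (@le_trans _ _ (\sum_(a <- None :: map Some H) h a)).
  apply: ler_sum_sub => [|a aO|//]; first exact: fset_uniq.
  case: a aO => [b|] bO; last by rewrite mem_head.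
  by rewrite in_cons /=; apply: map_f; rewrite mem_pmap map_id.
rewrite big_cons big_map lerD2l /h mulr_sumr.
have -> : \sum_(b <- H) tau_letter p n b * (U / x (tag b)) =
    \sum_(b <- H | P (tag b)) tau_letter p n b * (U / x (tag b)).
  rewrite [LHS]big_seq [RHS]big_seq_cond; apply: eq_bigl => b.
  case: (boolP (b \in H)) => // bH; have [v vF hv] := Hhd b bH.
  by rewrite (FP v b vF hv).
rewrite (partition_big (fun b => tag b) P)//=.
apply: ler_sum => j Pj.
rewrite (eq_bigl (fun b => tag b == j)); last first.
  by move=> b; apply: andb_idl => /eqP ->.
rewrite (eq_bigr (fun b => tau_letter p n b * (U / x j))); last first.
  by move=> b /eqP ->.
rewrite -mulr_suml.
apply: (@le_trans _ _ ((x j - 1) * (U / x j))).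
  by apply: ler_wpM2r; [rewrite divr_ge0// ltW|exact: sum_letters].
by apply: le_of_eq; field; rewrite gt_eqF.
Qed.

Lemma mean_subcritical : (mean_cluster_size (X := X) 1%g p < +oo)%E.
Proof.
apply: (@le_lt_trans _ _ (1 + U * \sum_(j | true) (1 - (x j)^-1))%:E); last exact: ltry.
apply: (mean_le lf cV) => F; apply: (sum_tau_le lf) => n.
apply: (@sum_words (\max_(v <- F) size (word v)) n xpredT F) => // v vF.
exact: leq_bigmax_seq.
Qed.

End Subcritical.

End FreeProductPercolation.

(** * The supercritical regime *)

Section WeightedUnion.
Variables (R : realType) (E : choiceType) (p : R).

(* Integrate [2 N - N^2 <= 1_(N > 0)], where [N = sum_t c t * 1_(B t)]. *)
Lemma prob_union_ge (T : eqType) (l : seq T) (c : T -> R)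
    (B : T -> set (config E)) (A : set (config E)) :
  measurable A -> (forall t, t \in l -> measurable (B t)) ->
  (forall t, t \in l -> B t `<=` A) ->
  2 * \sum_(t <- l) c t * prob p (B t)
    - \sum_(t <- l) \sum_(t' <- l) c t * c t' * prob p (B t `&` B t') <= prob p A.
Proof.
move=> mA mB BA.
have := @prob_lin R E p ((1, A) :: [seq (- (2 * c t), B t) | t <- l] ++
  [seq (c t * c t', B t `&` B t') | t <- l, t' <- l]).
rewrite big_cons big_cat /= mul1r big_map big_allpairs_dep /=.
have -> : \sum_(t <- l) - (2 * c t) * prob p (B t) = - (2 * \sum_(t <- l) c t * prob p (B t)).
  by rewrite mulr_sumr -sumrN; apply: eq_bigr => t _; ring.
move=> /(_ _ _)/wrap[||h].
3: by rewrite -subr_ge0; apply: (le_trans h); apply: le_of_eq; ring.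
  move=> x; rewrite in_cons map_cat mem_cat -!map_comp => /orP[/eqP->//|/orP[]].
    by move=> /mapP[t tl ->] /=; exact: mB.
  move=> /mapP[y /allpairsP[[t t'] [/= tl t'l ->]] ->] /=.
  by apply: measurableI; exact: mB.
move=> w; rewrite big_cons big_cat /= mul1r big_map big_allpairs_dep /=.
pose N := \sum_(t <- l) c t * \1_(B t) w.
have -> : \sum_(t <- l) - (2 * c t) * \1_(B t) w = - (2 * N).
  by rewrite mulr_sumr -sumrN; apply: eq_bigr => t _; ring.
have -> : \sum_(t <- l) \sum_(t' <- l) c t * c t' * \1_(B t `&` B t') w = N * N.
  rewrite /N mulr_suml; apply: eq_bigr => t _; rewrite mulr_sumr.
  apply: eq_bigr => t' _; rewrite indicI /=; ring.
rewrite indicE; case: (boolP (w \in A)) => [_|wA].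
  rewrite (_ : _ + _ = (1 - N) ^+ 2); first exact: sqr_ge0.
  by rewrite /=; ring.
rewrite (_ : N = 0); first by rewrite /= !mulr0 oppr0 !addr0.
rewrite /N big_seq big1// => t tl; rewrite indicE memNset ?mulr0//.
by move=> Bw; case/negP: wA; apply/mem_set/(BA t tl).
Qed.

Lemma prob_bigcap_ge (F : (set (config E))^nat) c : (forall n, measurable (F n)) ->
  nonincreasing_seq F -> (forall n, c <= prob p (F n)) -> c <= prob p (\bigcap_n F n).
Proof.
move=> mF niF hF; have mI : measurable (\bigcap_n F n) by exact: bigcapT_measurable.
have h : prob p (\bigcup_n ~` F n) <= 1 - c.
  have cv := @prob_cvg R E p (fun n => ~` F n) (fun n => measurableC (mF n)) _.
  rewrite -(cvg_lim _ (cv _))//; last first.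
    by move=> m n mn; apply/subsetPset/subsetC/subsetPset; exact: niF.
  apply: limr_le.
    apply/cvg_ex; exists (prob p (\bigcup_n ~` F n)); apply: cv.
    by move=> m n mn; apply/subsetPset/subsetC/subsetPset; exact: niF.
  by apply: nearW => n; rewrite probC// lerD2l lerN2.
rewrite -setC_bigcap probC// in h; lra.
Qed.

End WeightedUnion.

(** * Survival of a truncated branching process in the free product *)

Section Supercritical.
Variables (R : realType) (I : finType) (G : I -> groupType) (S : forall i, set (G i)).
Arguments S : clear implicits.
Hypothesis finS : forall i, finite_set (S i).
Hypothesis cG : forall i, countable [set: G i].
Local Notation V := (free_product G).
Local Notation X := (cayley (fp_gens S)).
Local Notation Y i := (cayley (S i)).
Local Notation lf := (cayley_locally_finite (finite_fp_gens finS)).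
Local Notation cV := (countable_free_product cG).
Local Notation cE := (@cayley_countable_edge _ (fp_gens S) cV).
Implicit Types (w : config (edge X)) (u v : V) (b c : letter G) (q : R).

Variables (L : seq (letter G)) (N : nat).
Hypothesis uL : uniq L.
Hypothesis L1 : forall b, b \in L -> tagged b != 1%g.

(* [survives k i]: some word of length [k] whose first letter is not of type [i]
   is reached from the origin by steps [b] in [L], each of them made inside a
   coset of the factor by an open path of length at most [N]. *)
Fixpoint survives k (i : I) : set (config (edge X)) :=
  if k is k'.+1 then
    \bigcup_(b in [set b | b \in L /\ tag b != i])
      (@factor_reach I G S N b `&`
       [set w : config (edge X) | survives k' (tag b) (w \o translate (fp_letter b))])
  else setT.

Definition off_type i : set (edge X) := [set e |
  hd_off i e.1 /\ hd_off i (e.1 * val e.2)%g].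

Definition step_event k b : set (config (edge X)) :=
  factor_reach N b `&`
  [set w : config (edge X) | survives k (tag b) (w \o translate (fp_letter b))].

Lemma survives_depends k i : depends (off_type i) (survives k i).
Proof.
elim: k i => [//|k IH] i; apply: depends_bigcup => b [bL bi]; apply: dependsI.
  move=> w w' h.
  apply: (@reach_sim (Y (tag b)) (Y (tag b)) _ _ id) => u v [e we ee].
  right; exists e => //; rewrite /= -h// /off_type /= -fp_inM /hd_off !hd_fp_in.
  by split; case: eqP.
move=> w w' h /=; apply: IH => e [h1 h2] /=; apply: h; split=> /=.
  by rewrite /hd_off /hd word_fp_letter_mul ?L1.
by rewrite -mulgA /hd_off /hd word_fp_letter_mul ?L1.
Qed.

(** Translation by [fp_letter b] puts [b] in front of the ends of the edges that matter, so survival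
    beyond distinct first letters is decided by disjoint edge sets. *)
Lemma shifted_survives_depends k b : b \in L -> depends (branch b)
  [set w : config (edge X) | survives k (tag b) (w \o translate (fp_letter b))].
Proof.
move=> bL w w' h /=; apply: survives_depends => e [h1 h2] /=; apply: h; split=> /=.
  by rewrite /hd word_fp_letter_mul ?L1.
by rewrite -mulgA /hd word_fp_letter_mul ?L1.
Qed.

Lemma measurable_shift (A : set (config (edge X))) g : measurable A ->
  measurable [set w : config (edge X) | A (w \o translate g)].
Proof.
apply: (@measurable_preim_config _ _ _ (fun w : config (edge X) => w \o translate g)).
by move=> e; exact: measurable_edge.
Qed.

Lemma measurable_survives k i : measurable (survives k i).
Proof.
elim: k i => [i|k IH i]; first exact: measurableT.
apply: fin_bigcup_measurable.
  by apply: (sub_finite_set _ (finite_seq L)) => b [].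
move=> b _; apply: measurableI; first exact: (measurable_factor_reach finS).
exact: (measurable_shift (A := survives k (tag b))).
Qed.

Lemma measurable_shifted_survives k b : measurable
  [set w : config (edge X) | survives k (tag b) (w \o translate (fp_letter b))].
Proof.
by apply: (measurable_shift (A := survives k (tag b))); exact: measurable_survives.
Qed.

Lemma measurable_step_event k b : measurable (step_event k b).
Proof.
apply: measurableI; first exact: (measurable_factor_reach finS).
exact: measurable_shifted_survives.
Qed.

Lemma survives_reach k i w : survives k i w ->
  exists v, [/\ size (word v) = k, hd_off i v &
               cluster (X := X) 1%g w v].
Proof.
elim: k i w => [i w _|k IH i w [b [bL bi] [r /IH [v [vk hv cv]]]]].
  by exists 1%g; split=> //; exact: rt_refl.
have W := word_fp_letter_mul (L1 bL) hv.
exists (fp_letter b * v)%g; rewrite W /hd_off /hd W /=; split=> //; first by rewrite vk.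
have c1 : cluster (X := X) 1%g w (fp_letter b).
  apply/clusterP; exists N; rewrite -(fp_in1 G (tag b)).
  apply: (@reach_sim (Y (tag b)) X _ w (fp_in (tag b)) _ N 1%g (tagged b) r).
  move=> x y [e we ee]; right; exists (embed e) => //.
  by rewrite ends_embed; case: ee => -[<- <-]; [left|right].
apply: (rt_trans _ _ _ (fp_letter b)) => //.
move/clusterP: cv => [m /reach_translate rm]; rewrite mulg1 in rm.
by have : cluster (X := X) (fp_letter b) w (fp_letter b * v)%g by apply/clusterP; exists m.
Qed.

Section Fixed.
Variable p : R.
Hypothesis p01 : 0 <= p <= 1.

Local Notation s k i := (prob p (survives k i)).

Lemma prob_shift (A : set (config (edge X))) g : measurable A ->
  prob p [set w : config (edge X) | A (w \o translate g)] = prob p A.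
Proof. by move=> mA; apply: (prob_push cE cE p01 _ mA); exact: translate_inj. Qed.

Lemma prob_step_event k b : b \in L ->
  prob p (step_event k b) = tau_letter S p N b * s k (tag b).
Proof.
move=> bL; rewrite /step_event (prob_indep cE p01 _ _ (@factor_reach_depends _ _ S N b)
  (@shifted_survives_depends k b bL)).
- by rewrite prob_factor_reach// prob_shift//; exact: measurable_survives.
- exact: (measurable_factor_reach finS).
- exact: measurable_shifted_survives.
- exact: branch_crossing.
Qed.

(** The connections to [b] and [c] inside the factors may be correlated, so they are dropped; the
    survival events in the two branches are independent. *)
Lemma prob_step_event2 k b c : b \in L -> c \in L -> b != c ->
  prob p (step_event k b `&` step_event k c) <= s k (tag b) * s k (tag c).
Proof.
move=> bL cL bc; pose A d := [set w : config (edge X) |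
  survives k (tag d) (w \o translate (fp_letter d))].
have mA d : measurable (A d) by exact: measurable_shifted_survives.
apply: (@le_trans _ _ (prob p (A b `&` A c))).
  apply: prob_le.
  - by apply: measurableI; exact: measurable_step_event.
  - exact: measurableI.
  - by move=> w [[_ ?] [_ ?]].
rewrite (prob_indep cE p01 (mA b) (mA c) (@shifted_survives_depends k b bL)
  (@shifted_survives_depends k c cL)) ?branch_disjoint//.
by rewrite !prob_shift//; exact: measurable_survives.
Qed.

(** Survival to depth [k] puts a word of length [k] into the cluster. By continuity from above, the
    cluster contains words of unbounded length with probability at least [eta]. *)
Lemma theta_gt0 i (eta : R) : 0 < eta -> (forall k, eta <= s k i) ->
  (0 < theta (X := X) 1%g p)%E.
Proof.
move=> c0 hc.
pose F k : set (config (edge X)) :=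
  \bigcup_(v in [set v : V | (k <= size (word v))%N]) [set w | cluster (X := X) 1%g w v].
have mF k : measurable (F k).
  rewrite /F bigcup_mkcond; apply: countable_bigcupT_measurable cV _ => v.
  by case: ifP => // _; exact: (measurable_connected lf).
have minf := measurable_infinite_cluster lf cV (1%g : V).
have h : eta <= prob p (\bigcap_k F k).
  apply: prob_bigcap_ge => // [m n mn|k].
    by apply/subsetPset => w [v /= nv cv]; exists v => //=; exact: (leq_trans mn).
  apply: (le_trans (hc k)); apply: prob_le => //; first exact: measurable_survives.
  by move=> w /survives_reach[v [vk _ cv]]; exists v => //=; rewrite vk.
rewrite /theta (probE p minf) lte_fin; apply: (lt_le_trans c0); apply: (le_trans h).
apply: prob_le => //; first exact: bigcapT_measurable.
move=> w hw /= fin.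
pose M := \max_(v <- fset_set (cluster (X := X) 1%g w)) size (word v).
have [v /= Mv cv] := hw M.+1 Logic.I.
suff : (size (word v) <= M)%N by rewrite leqNgt Mv.
by apply: (leq_bigmax_seq (F := fun v : V => size (word v))) => //; rewrite in_fset_set// inE.
Qed.

Section Survival.
(** Here [a j] and [x j] are the truncated counterparts of [chi_j - 1] and [1 / chi_j]. *)
Let a j := \sum_(b <- L | tag b == j) tau_letter S p N b.
Let x j := (1 + a j)^-1.
Hypothesis super : 1 < \sum_j (1 - x j).

Let a0 j : 0 <= a j. Proof. by apply: sumr_ge0 => b _; exact: prob_ge0. Qed.
Let x0 j : 0 < x j. Proof. by rewrite invr_gt0 ltr_pwDl. Qed.
Let x1 j : x j <= 1. Proof. by rewrite invf_le1 ?lerDl// ltr_pwDl. Qed.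
Let ax j : a j * x j = 1 - x j.
Proof. by rewrite /x; field; rewrite gt_eqF// ltr_pwDl. Qed.

Let m : R := (size L)%:R.
Let delta := \sum_j (1 - x j) - 1.
(** Small enough that the second-order error [eps ^+ 2 * m ^+ 2] is at most the first-order gain
    [eps * delta]; the bound by [1] serves the case [k = 0]. *)
Let eps := Num.min 1 (delta / (m ^+ 2 + 1)).

Let m0 : 0 <= m. Proof. exact: ler0n. Qed.

Let eps0 : 0 < eps.
Proof. by rewrite lt_min ltr01/= divr_gt0 ?subr_gt0// ltr_wpDl ?exprn_ge0. Qed.

Let eps_small : eps * m ^+ 2 <= delta.
Proof.
have m2 : 0 <= m ^+ 2 by rewrite exprn_ge0.
have d0 : 0 < delta by rewrite subr_gt0.
apply: (@le_trans _ _ (delta / (m ^+ 2 + 1) * m ^+ 2)).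
  by apply: ler_wpM2r => //; rewrite ge_min lexx orbT.
rewrite mulrAC ler_pdivrMr ?ltr_wpDl//.
by rewrite ler_wpM2l ?(ltW d0)// lerDl.
Qed.

(** The first moment is [Z = eps * (delta + x i)]. In the second moment the diagonal is at most [Z]
    and the rest at most [eps ^+ 2 * m ^+ 2], so [2 * Z] minus the second moment is still at least
    [eps * x i]. *)
Lemma survives_ge k i : eps * x i <= s k i.
Proof.
elim: k i => [|k IH] i.
  by rewrite prob_setT mulr_ile1 ?(ltW eps0) ?(ltW (x0 _))// ge_min lexx.
pose l := [seq b <- L | tag b != i].
have lL b : b \in l -> b \in L by rewrite mem_filter => /andP[].
have ul : uniq l by rewrite filter_uniq.
have s0 j : 0 < s k j by apply: lt_le_trans (IH j); rewrite mulr_gt0.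
(* These weights scale the survival probabilities down to the bound to be
   propagated, so that the off-diagonal terms are at most [eps ^+ 2]. *)
pose c b := eps * x (tag b) / s k (tag b).
have cs b : c b * s k (tag b) = eps * x (tag b) by rewrite /c divfK// gt_eqF.
have c0 b : 0 <= c b by rewrite divr_ge0 ?prob_ge0// mulr_ge0// ltW.
have c1 b : c b <= 1 by rewrite ler_pdivrMr// mul1r.
have := @prob_union_ge R (edge X) p _ l c (step_event k) (survives k.+1 i)
  (measurable_survives k.+1 i) (fun b _ => measurable_step_event k b) _.
move=> /(_ _)/wrap[|].
  by move=> b; rewrite mem_filter => /andP[bi bL] w wb; exists b.
apply: le_trans.
pose Z := \sum_(b <- l) c b * prob p (step_event k b).
have ZE : Z = eps * \sum_(j | j != i) (1 - x j).
  rewrite /Z big_filter (partition_big (fun b => tag b) (fun j => j != i))//=.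
  rewrite mulr_sumr; apply: eq_bigr => j ji.
  transitivity (\sum_(b <- L | tag b == j) tau_letter S p N b * (eps * x j)); last first.
    by rewrite -mulr_suml -/(a j) -ax; ring.
  rewrite big_seq_cond [RHS]big_seq_cond; apply: eq_big => [b|b].
    by case: (tag b =P j) => [->|_]; rewrite ?ji ?andbF.
  move=> /andP[bL /andP[_ /eqP bj]]; rewrite prob_step_event// mulrCA cs.
  by rewrite bj; ring.
have h2 : \sum_(b <- l) \sum_(b' <- l) c b * c b' *
    prob p (step_event k b `&` step_event k b') <= Z + eps ^+ 2 * m ^+ 2.
  apply: (@le_trans _ _ (\sum_(b <- l) \sum_(b' <- l)
      ((b' == b)%:R * (c b * prob p (step_event k b)) + eps ^+ 2))).
    rewrite [leLHS]big_seq [leRHS]big_seq; apply: ler_sum => b bl.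
    rewrite [leLHS]big_seq [leRHS]big_seq; apply: ler_sum => b' b'l.
    have [->|bb'] := eqVneq b' b.
      rewrite setIid mul1r; apply: ler_wpDr; first exact: sqr_ge0.
      rewrite ler_wpM2r ?prob_ge0// ler_piMr//.
    rewrite mul0r add0r.
    apply: (@le_trans _ _ (c b * c b' * (s k (tag b) * s k (tag b')))).
      apply: ler_wpM2l; first exact: mulr_ge0.
      by apply: prob_step_event2; [exact: lL|exact: lL|rewrite eq_sym].
    rewrite mulrACA !cs mulrACA -expr2 ler_piMr ?sqr_ge0//.
    by rewrite mulr_ile1// ltW.
  rewrite [leLHS](_ : _ = Z + eps ^+ 2 * (size l)%:R ^+ 2); last first.
    transitivity (\sum_(b <- l)
        (c b * prob p (step_event k b) + eps ^+ 2 *+ size l)).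
      apply: eq_big_seq => b bl; rewrite big_split/=; congr (_ + _); last first.
        by rewrite big_const_seq count_predT iter_addr_0.
      rewrite -mulr_suml (bigD1_seq b)//= eqxx big1 ?addr0 ?mul1r// => b' bb'.
      by rewrite (negbTE bb').
    rewrite big_split/= -/Z; congr (_ + _).
    by rewrite big_const_seq count_predT iter_addr_0 -mulrnA -[LHS]mulr_natr natrM -expr2.
  rewrite lerD2l ler_wpM2l ?sqr_ge0// lerXn2r ?nnegrE// ler_nat.
  by rewrite size_filter count_size.
rewrite -/Z.
have dE : \sum_(j | j != i) (1 - x j) = delta + x i.
  by rewrite /delta [in RHS](bigD1 i)//=; ring.
move: h2; set W := \sum_(b <- l) _ => h2.
have : eps * (eps * m ^+ 2) <= eps * delta by rewrite ler_wpM2l// ltW.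
move: ZE; rewrite dE; lra.
Qed.

Lemma theta_supercritical (i : I) : (0 < theta (X := X) 1%g p)%E.
Proof. by apply: (@theta_gt0 i (eps * x i)) => [|k]; [rewrite mulr_gt0|exact: survives_ge]. Qed.

End Survival.

End Fixed.

End Supercritical.

(** * The critical point *)

Section Generation.
Variables (G : groupType) (S : set G).

Lemma generates_nontrivial : generates S -> (exists x : G, x != 1%g) ->
  exists s : S, val s != 1%g.
Proof.
move=> genS [x x1]; apply: contrapT => /forallNP h.
have S1 : S `<=` [set 1%g].
  move=> s Ss /=; apply/eqP/negPn/negP => s1.
  exact: (h (exist _ s (mem_set Ss))).
have : smallest (fun H : set G => group_closed (mem H)) S x by rewrite genS.
move=> /(@smallest_sub _ _ S [set 1%g] _ S1) => /(_ _)/wrap[|/eqP]; last by rewrite (negbTE x1).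
split; first by apply/mem_set.
by move=> u v /set_mem /= -> /set_mem /= ->; apply/mem_set; rewrite /= mulgV.
Qed.

(** The values of finite words in generators and their inverses form a subgroup containing [S],
    hence everything; a letter is coded by a sign and an index into a list of [S]. *)
Lemma generates_countable : finite_set S -> generates S -> countable [set: G].
Proof.
move=> finS genS; pose l := enum_fset (fset_set S).
pose letter_val (a : bool * nat) : G :=
  if a.1 then nth 1%g l a.2 else (nth 1%g l a.2)^-1%g.
pose ev (s : seq (bool * nat)) : G := foldr (fun a x => (letter_val a * x)%g) 1%g s.
have ev_cat s t : ev (s ++ t) = (ev s * ev t)%g.
  by elim: s => [|a s IH]; rewrite /= ?mul1g// IH mulgA.
pose flip (a : bool * nat) := (~~ a.1, a.2).
have ev_rev s : ev (rev (map flip s)) = (ev s)^-1%g.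
  elim: s => [|a s IH]; first by rewrite /= invg1.
  rewrite map_cons rev_cons -cats1 ev_cat IH /= mulg1 invgM; congr (_ * _)%g.
  by rewrite /letter_val /flip /=; case: (a.1) => //=; rewrite invgK.
have evS x : exists s, ev s = x.
  have Sx : smallest (fun H : set G => group_closed (mem H)) S x by rewrite genS.
  suff [s _ <-] : range ev x by exists s.
  apply: smallest_sub Sx => [|y Sy]; last first.
    have yl : y \in l by rewrite /l in_fset_set// inE.
    by exists [:: (true, index y l)] => //=; rewrite /letter_val/= nth_index// mulg1.
  split; first by apply/mem_set; exists [::].
  move=> _ _ /set_mem[s _ <-] /set_mem[t _ <-]; apply/mem_set.
  by exists (s ++ rev (map flip t)) => //; rewrite ev_cat ev_rev.
pose g x := sval (cid (evS x)).
have gK x : ev (g x) = x by rewrite /g; case: cid.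
apply: (@countable_inj _ (fun x => choice.pickle (g x))).
by move=> x y /(pcan_inj choice.pickleK) h; rewrite -[x]gK h gK.
Qed.

End Generation.

(** * The equation at the critical point and its uniqueness *)

Section CriticalPoint.
Variables (R : realType) (I : finType) (G : I -> groupType) (S : forall i, set (G i)).
Arguments S : clear implicits.
Hypothesis finS : forall i, finite_set (S i).
Hypothesis cG : forall i, countable [set: G i].
Hypothesis gens_neq1 : forall i, exists s : S i, val s != 1%g.
Hypothesis card_I : (1 < #|I|)%N.
Local Notation X := (cayley (fp_gens S)).
Local Notation Y i := (cayley (S i)).
Local Notation lf := (cayley_locally_finite (finite_fp_gens finS)).
Local Notation lfY i := (cayley_locally_finite (finS i)).
Local Notation cV := (countable_free_product cG).
Implicit Types (p q : R).

Local Notation chi i p := (@chi R I G S i p).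
Local Notation theta p := (@theta R X 1%g p).

Let exists_neq (i : I) : exists j, j != i.
Proof.
apply: contrapT => /forallNP h.
have : (#|I| <= #|pred1 i|)%N.
  by apply: subset_leq_card; apply/fintype.subsetP => j _; apply/negPn/negP; exact: h.
by rewrite card1 leqNgt card_I.
Qed.

Let I_inhabited : inhabited I.
Proof.
have : (0 < #|I|)%N by exact: ltnW.
by move=> /card_gt0P[i _]; exists.
Qed.

(** At [p = 1] one non-trivial generator per factor gives survival with probability one, as another
    type is always available. So the set defining the critical probability is non-empty. *)
Lemma theta1_gt0 : (0 < theta 1)%E.
Proof.
have p01 : 0 <= (1 : R) <= 1 by rewrite ler01 lexx.
pose s i := sval (cid (gens_neq1 i)).
have s1 i : val (s i) != 1%g by rewrite /s; case: cid.
pose L : seq (letter G) := [seq Tagged G (val (s i)) | i <- enum I].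
have L1 b : b \in L -> tagged b != 1%g by move=> /mapP[i _ ->].
have [i0] := I_inhabited.
apply: (@theta_gt0 R I G S finS cG L 1 L1 1 i0 1) => // k.
elim: k i0 => [|k IH] i; first by rewrite prob_setT.
have [j ji] := exists_neq i.
pose b : letter G := Tagged G (val (s j)).
have bL : b \in L by apply: map_f; rewrite mem_enum.
apply: (@le_trans _ _ (prob (1 : R) (@step_event I G S L 1 k b))).
  rewrite (prob_step_event finS cG 1 L1 p01 k bL).
  rewrite -[leLHS]mulr1; apply: ler_pM => //.
  exact: (@tauN_gen_ge R (G j) (S j) (finS j) (cG j) 1 (s j) p01).
apply: prob_le; [exact: (measurable_step_event finS)|exact: (measurable_survives finS)|].
by move=> w wb; exists b.
Qed.

(** A summand of [f] with the convention [1 / +oo = 0], so that the supercritical argument covers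
    infinite [chi i]. *)
Definition defect i p : R := if chi i p == +oo%E then 1 else 1 - (fine (chi i p))^-1.

Lemma chi_gt1 i p : 0 < p <= 1 -> (1 < chi i p)%E.
Proof.
move=> /andP[p0 p1]; have [s s1] := gens_neq1 i.
have p01 : 0 <= p <= 1 by rewrite p1 ltW.
apply: (@lt_le_trans _ _ (1 + \sum_(x <- [:: val s]) tauN (X := Y i) p 1 1%g x)%:E).
  rewrite lte_fin ltrDl big_seq1; apply: (lt_le_trans p0).
  exact: (tauN_gen_ge (finS i) (cG i)).
by apply: (sum_tau_factor finS cG) => //; rewrite inE eq_sym.
Qed.

Lemma defect_gt0 i p : 0 < p <= 1 -> 0 < defect i p.
Proof.
move=> /(chi_gt1 i); rewrite /defect; case: (chi i p) => [r| |] //=.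
by rewrite lte_fin => r1; rewrite subr_gt0 invf_lt1// (lt_trans _ r1).
Qed.

(** For positive [y] and [c < 1], [c < 1 - 1 / y] means [(1 - c)^-1 < y], and the mean cluster size
    is a supremum over finite vertex sets and path lengths. The bound holds for all large [N], so
    one length can serve all factors. *)
Lemma defect_trunc i p c : 0 <= p <= 1 -> c < defect i p ->
  exists (L : seq (G i)) (N0 : nat), [/\ uniq L, 1%g \notin L &
    forall N, (N0 <= N)%N -> c < 1 - (1 + \sum_(x <- L) tauN (X := Y i) p N 1%g x)^-1].
Proof.
move=> p01 cd; have chi1 := @chi_ge1 R I G S finS cG i p.
have c1 : c < 1.
  apply: (lt_le_trans cd); rewrite /defect; case: eqP => // _.
  rewrite lerBlDr lerDl invr_ge0 fine_ge0//.
  by apply: le_trans chi1; rewrite lee_fin.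
have c0 : 0 < 1 - c by rewrite subr_gt0.
have rchi : ((1 - c)^-1%:E < chi i p)%E.
  move: cd chi1; rewrite /defect; case: (chi i p) => [r| |] //=; last by rewrite ltry.
  rewrite lte_fin lee_fin => cr r1; have r0 : 0 < r by apply: lt_le_trans r1.
  by rewrite invf_plt ?posrE//; lra.
have [F hF] : exists F : {fset G i}, (1 - c)^-1 < \sum_(x <- F) tau (X := Y i) p 1%g x.
  apply: contrapT => /forallNP h.
  have : (chi i p <= (1 - c)^-1%:E)%E.
    by apply: (mean_le (lfY i) (cG i)) => F; rewrite leNgt; apply/negP/h.
  by rewrite leNgt rchi.
pose L := [seq x <- F | x != 1%g].
have uL : uniq L by rewrite filter_uniq// fset_uniq.
have hL : (1 - c)^-1 - 1 < \sum_(x <- L) tau (X := Y i) p 1%g x.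
  rewrite ltrBlDl; apply: (lt_le_trans hF).
  apply: (@le_trans _ _ (\sum_(x <- 1%g :: L) tau (X := Y i) p 1%g x)).
    apply: ler_sum_sub => [|x xF|x]; [exact: fset_uniq| |exact: tau_ge0].
    by rewrite in_cons mem_filter xF andbT orbN.
  rewrite big_cons lerD2r; apply: prob_le1; exact: (measurable_connected (lfY i)).
have [N0 hN0] : exists N0, (1 - c)^-1 - 1 < \sum_(x <- L) tauN (X := Y i) p N0 1%g x.
  apply: contrapT => /forallNP h; move: hL; rewrite ltNge => /negP; apply.
  by apply: (sum_tau_le (lfY i)) => n; rewrite leNgt; apply/negP/h.
exists L, N0; split=> //; first by rewrite mem_filter eqxx.
move=> N N0N.
have hN : (1 - c)^-1 < 1 + \sum_(x <- L) tauN (X := Y i) p N 1%g x.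
  rewrite -ltrBlDl; apply: (lt_le_trans hN0); apply: ler_sum => x _.
  exact: (tauN_nd (lfY i)).
have := hN; rewrite invf_plt ?posrE//; last first.
  by apply: lt_trans hN; rewrite invr_gt0.
lra.
Qed.

(** The truncated [f] is built from finitely many polynomials in the parameter, hence continuous at
    [p], and it stays above [1] nearby. *)
Lemma supercritical_open p : 0 <= p <= 1 -> 1 < \sum_i defect i p ->
  exists2 eps, 0 < eps & forall q, 0 <= q <= 1 -> `|q - p| < eps -> (0 < theta q)%E.
Proof.
move=> p01 super; have [i0] := I_inhabited.
(* Losing [delta] in each of the [#|I|] terms leaves a sum of [1 + delta]. *)
pose delta := (\sum_i defect i p - 1) / (#|I|%:R + 1).
have D0 : 0 < (#|I|%:R + 1 : R) by rewrite ltr_wpDl.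
have delta0 : 0 < delta by rewrite divr_gt0 ?subr_gt0.
have tr i : exists LN : seq (G i) * nat, [/\ uniq LN.1, 1%g \notin LN.1 &
    forall N, (LN.2 <= N)%N -> defect i p - delta <
      1 - (1 + \sum_(x <- LN.1) tauN (X := Y i) p N 1%g x)^-1].
  have [|L [N0 h]] := @defect_trunc i p (defect i p - delta) p01; first by rewrite gtrBl.
  by exists (L, N0).
pose L i := (sval (cid (tr i))).1; pose N i := (sval (cid (tr i))).2.
have LP i : [/\ uniq (L i), 1%g \notin L i &
    forall n, (N i <= n)%N -> defect i p - delta <
      1 - (1 + \sum_(x <- L i) tauN (X := Y i) p n 1%g x)^-1].
  by rewrite /L /N; case: cid.
pose M := \max_i N i.
pose LL : seq (letter G) := [seq Tagged G x | i <- enum I, x <- L i].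
have uLL : uniq LL.
  apply: allpairs_uniq_dep; first exact: enum_uniq.
    by move=> i _; case: (LP i).
  by move=> [i x] [j y] _ _ /= h.
have LL1 b : b \in LL -> tagged b != 1%g.
  move=> /allpairsPdep[i [x [_ xL ->]]] /=; apply: contraTN xL => /eqP ->.
  by case: (LP i).
pose a q j := \sum_(x <- L j) tauN (X := Y j) q M 1%g x.
have aE q j : \sum_(b <- LL | tag b == j) tau_letter S q M b = a q j.
  rewrite big_mkcond big_allpairs_dep/= (bigD1_seq j)/= ?mem_enum ?enum_uniq//.
  rewrite [X in _ + X]big1 ?addr0; last first.
    by move=> i ij; rewrite big1// => x _; rewrite (negbTE ij).
  by apply: eq_bigr => x _; rewrite eqxx.
have polyP j : exists Q : {poly R}, forall q, 0 <= q <= 1 -> a q j = Q.[q].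
  have /boolp.choice[Qx hQx] : forall x, exists Q : {poly R}, forall q, 0 <= q <= 1 ->
      tauN (X := Y j) q M 1%g x = Q.[q].
    move=> x; have [l hl] := reach_finite_depends (lfY j) M 1%g x.
    exact: (finite_depends_poly R (@cayley_countable_edge _ (S j) (cG j)) hl).
  exists (\sum_(x <- L j) Qx x) => q q01; rewrite horner_sum.
  by apply: eq_bigr => x _; exact: hQx.
have [Q hQ] := boolp.choice polyP.
have a0 q j : 0 <= a q j by apply: sumr_ge0 => x _; exact: prob_ge0.
pose f q := \sum_j (1 - (1 + (Q j).[q])^-1).
have f1 : 1 < f p.
  apply: (@lt_le_trans _ _ (\sum_j (defect j p - delta))).
    rewrite sumrB sumr_const -mulr_natr.
    have : delta * (#|I|%:R + 1) = \sum_i defect i p - 1 by rewrite divfK// gt_eqF.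
    lra.
  apply: ler_sum => j _; apply: ltW; rewrite -hQ//; have [_ _] := LP j; apply.
  exact: leq_bigmax.
have cf : f q @[q --> p] --> f p.
  apply: cvg_big => [|j _]; first exact: add_continuous.
  apply: cvgB; first exact: cvg_cst.
  apply: cvgV; first by rewrite -hQ// gt_eqF// ltr_pwDl.
  apply: cvgD; [exact: cvg_cst|exact: continuous_horner].
have /nbhs_ballP[eps /= eps0 heps] : \forall q \near p, 1 < f q.
  exact: (cvgr_gt _ cf).
exists eps => // q q01 qp.
apply: (@theta_supercritical R I G S finS cG LL M uLL LL1 q q01 _ i0).
rewrite (eq_bigr (fun j => 1 - (1 + (Q j).[q])^-1)).
  by apply: heps; rewrite /ball/= distrC.
by move=> j _; rewrite aE hQ.
Qed.

Let pc : R := critical_probability R (X := X) 1%g.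
Let Theta : set R := [set p : R | 0 <= p <= 1 /\ (0 < theta p)%E].

Let Theta_has_inf : has_inf Theta.
Proof.
split; first by exists 1; split; [rewrite ler01 lexx|exact: theta1_gt0].
by exists 0 => p [/andP[]].
Qed.

Let pc_le p : 0 <= p <= 1 -> (0 < theta p)%E -> pc <= p.
Proof. by move=> p01 tp; apply: ge_inf; [exact: (proj2 Theta_has_inf)|split]. Qed.

Let not_theta p : (mean_cluster_size (X := X) 1%g p < +oo)%E -> ~ (0 < theta p)%E.
Proof. by move=> /(theta_eq0 lf cV) ->; rewrite ltxx. Qed.

(** The mean cluster size is finite at [0], hence near [0], and there [theta] vanishes. *)
Lemma pc_gt0 : 0 < pc.
Proof.
have [|eps eps0 h] := @mean_finite_open R _ _ (finite_fp_gens finS) cV 0 _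
  (@mean0_lty R _ _ (finite_fp_gens finS) cV).
  by rewrite lexx ler01.
apply: (lt_le_trans eps0); apply: lb_le_inf; first exact: (proj1 Theta_has_inf).
move=> q [q01 tq]; rewrite leNgt; apply/negP => qe.
apply: (not_theta _ tq); apply: h => //; rewrite subr0 ger0_norm//.
by case/andP: q01.
Qed.

Lemma pc_le1 : pc <= 1.
Proof. by apply: pc_le; [rewrite ler01 lexx|exact: theta1_gt0]. Qed.

Let pc01 : 0 <= pc <= 1.
Proof. by rewrite (ltW pc_gt0) pc_le1. Qed.

(** Otherwise [theta] would be positive at some point below [pc]. *)
Lemma sum_defect_pc_le1 : \sum_i defect i pc <= 1.
Proof.
rewrite leNgt; apply/negP => /(supercritical_open pc01)[eps eps0 h].
(* The maximum keeps [q] in the unit interval; it is still below [pc] because [pc > 0]. *)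
pose q := Num.max 0 (pc - eps / 2).
have e2 : 0 < eps / 2 by rewrite divr_gt0.
have qpc : q < pc by rewrite gt_max pc_gt0/= gtrBl divr_gt0.
have q0 : 0 <= q by rewrite le_max lexx.
have q01 : 0 <= q <= 1 by rewrite q0 (le_trans (ltW qpc) pc_le1).
suff /(pc_le q01) : (0 < theta q)%E by rewrite leNgt qpc.
apply: h => //; rewrite ler0_norm ?subr_le0 ?(ltW qpc)// opprB ltrBlDl.
have : pc - eps / 2 <= q by rewrite le_max lexx orbT.
lra.
Qed.

(** An infinite [chi i] would contribute [1] to the sum and a second factor a positive amount,
    against [sum_defect_pc_le1]. *)
Lemma chi_pc_fin i : chi i pc \is a fin_num.
Proof.
have pc01' : 0 < pc <= 1 by rewrite pc_gt0 pc_le1.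
have c1 := chi_gt1 i pc01'.
case E : (chi i pc) c1 => [r| |] // _; exfalso.
have [j ji] := exists_neq i.
have := sum_defect_pc_le1; rewrite (bigD1 i)//= (bigD1 j)//= {1}/defect E eqxx.
apply/negP; rewrite -ltNge ltrDl ltr_wpDr ?defect_gt0//.
by apply: sumr_ge0 => k _; exact/ltW/defect_gt0.
Qed.

Lemma defect_fin i p : chi i p \is a fin_num -> defect i p = 1 - (fine (chi i p))^-1.
Proof. by rewrite /defect; case: (chi i p). Qed.

(** If the sum were below [1], the mean cluster size of the free product would be finite at [pc] and
    in a neighbourhood, whereas the infimum has points with [theta > 0] arbitrarily close. *)
Lemma sum_defect_pc : \sum_i (1 - (fine (chi i pc))^-1) = 1.
Proof.
have sE : \sum_i defect i pc = \sum_i (1 - (fine (chi i pc))^-1).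
  by apply: eq_bigr => i _; rewrite defect_fin// chi_pc_fin.
apply/eqP; rewrite eq_le -{1}sE sum_defect_pc_le1/= leNgt; apply/negP => sub.
have fin := @mean_subcritical R I G S finS cG pc pc01 chi_pc_fin sub.
have [eps eps0 h] := mean_finite_open (finite_fp_gens finS) cV pc01 fin.
have [q [q01 tq] qpc] := inf_adherent eps0 Theta_has_inf.
apply: (not_theta _ tq); apply: h => //.
by rewrite ger0_norm ?subr_ge0 ?pc_le// ltrBlDl.
Qed.

Lemma sum_defect_strict p q : 0 < p -> p < q -> q <= 1 ->
  (forall i, chi i p \is a fin_num) -> (forall i, chi i q \is a fin_num) ->
  \sum_i (1 - (fine (chi i p))^-1) < \sum_i (1 - (fine (chi i q))^-1).
Proof.
move=> p0 pq q1 finp finq; have [i0] := I_inhabited.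
have lt i : 1 - (fine (chi i p))^-1 < 1 - (fine (chi i q))^-1.
  have [s s1] := gens_neq1 i.
  have := mean_strict (finS i) (cG i) (ltW p0) pq q1 s1 (finq i).
  have := @chi_ge1 R I G S finS cG i p; rewrite -(fineK (finp i)) lee_fin => x1 xy.
  have xp : 0 < fine (chi i p) := lt_le_trans ltr01 x1.
  by rewrite ltrD2l ltrN2 ltf_pV2 ?posrE//; exact: lt_trans xy.
rewrite (bigD1 i0)//= [ltRHS](bigD1 i0)//=; apply: ltr_leD => //.
by apply: ler_sum => i _; exact: ltW.
Qed.

Lemma sum_defect_unique p : 0 < p <= 1 -> (forall i, chi i p \is a fin_num) ->
  \sum_i (1 - (fine (chi i p))^-1) = 1 -> p = pc.
Proof.
move=> /andP[p0 p1] finp s1; apply/eqP; rewrite eq_le !leNgt.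
apply/andP; split; apply/negP => lt.
- have := sum_defect_strict pc_gt0 lt p1 chi_pc_fin finp.
  by rewrite s1 sum_defect_pc ltxx.
- have := sum_defect_strict p0 lt pc_le1 finp chi_pc_fin.
  by rewrite s1 sum_defect_pc ltxx.
Qed.

End CriticalPoint.

(** Factoring out the product of the [x i] turns the equation of the theorem into [f = 1]. *)
Lemma sum_prod_inv (F : fieldType) (I : finType) (x : I -> F) :
  (forall i, x i != 0) ->
  \sum_j \prod_(i | i != j) x i - (#|I|%:R - 1) * \prod_i x i =
  \prod_i x i * (1 - \sum_i (1 - (x i)^-1)).
Proof.
move=> x0; have -> : \sum_j \prod_(i | i != j) x i = \prod_i x i * \sum_j (x j)^-1.
  by rewrite mulr_sumr; apply: eq_bigr => j _; rewrite [in RHS](bigD1 j)//= mulrAC divff ?mul1r.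
by rewrite sumrB sumr_const; ring.
Qed.

Theorem corollary4 (R : realType) (n : nat) (G : 'I_n -> groupType)
    (S : forall i : 'I_n, set (G i))
    (n_ge2 : (2 <= n)%N)
    (G_nontrivial : forall i : 'I_n, exists x : G i, x != 1%g)
    (S_finite : forall i : 'I_n, finite_set (S i))
    (S_generates : forall i : 'I_n, generates (S i)) :
  let pc : R := critical_probability R (X := cayley (fp_gens S)) 1%g in
  let chi (i : 'I_n) (p : R) : \bar R :=
    mean_cluster_size (X := cayley (S i)) 1%g p in
  let solution (p : R) : Prop :=
    (forall i : 'I_n, chi i p \is a fin_num) /\
    \sum_(j < n) \prod_(i < n | i != j) fine (chi i p)
      - (n%:R - 1) * \prod_(i < n) fine (chi i p) = 0 in
  0 < pc <= 1 /\ solution pc /\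
  (forall p : R, 0 < p <= 1 -> solution p -> p = pc).
Proof.
move=> pc chi0 solution.
have cG i : countable [set: G i] := generates_countable (S_finite i) (S_generates i).
have gens i := generates_nontrivial (S_generates i) (G_nontrivial i).
have cI : (1 < #|'I_n|)%N by rewrite card_ord.
have x0 p i : chi0 i p \is a fin_num -> fine (chi0 i p) != 0.
  move=> fin; have : (1 <= chi0 i p)%E := chi_ge1 S_finite cG i p.
  rewrite -(fineK fin) lee_fin => h.
  by rewrite gt_eqF// (lt_le_trans _ h).
have solE p : (forall i, chi0 i p \is a fin_num) ->
    \sum_(j < n) \prod_(i < n | i != j) fine (chi0 i p)
      - (n%:R - 1) * \prod_(i < n) fine (chi0 i p) = 0 <->
    \sum_i (1 - (fine (chi0 i p))^-1) = 1.
  move=> fin; have x0p i : fine (chi0 i p) != 0 by exact: x0.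
  have := sum_prod_inv x0p; rewrite card_ord => ->; split=> [/eqP|->].
    have /negbTE P0 : \prod_i fine (chi0 i p) != 0 by apply/prodf_neq0 => i _.
    by rewrite mulf_eq0 P0 subr_eq0 => /eqP <-.
  by rewrite subrr mulr0.
split; first by rewrite (pc_gt0 R S_finite cG gens cI) (pc_le1 R S_finite cG gens cI).
have finpc i : chi0 i pc \is a fin_num by exact: (chi_pc_fin R S_finite cG gens cI).
split.
  by split=> //; apply/solE => //; exact: (sum_defect_pc R S_finite cG gens cI).
move=> p p01 [fin /(solE _ fin) s1].
exact: (sum_defect_unique S_finite cG gens cI p01 fin s1).
Qed.
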